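(* Let $G$ be one of the Lie groups $G_{4,1,1}$, $G_{4,1,2}$, $G_{4,2,1(\lambda)}$, $G_{4,2,2}$, $G_{4,2,3(\varphi)}$ ($\varphi\neq\frac{\pi}{2}$), $G_{4,3,1(\lambda_1,\lambda_2)}$, $G_{4,3,2(\lambda)}$, $G_{4,3,3}$, $G_{4,3,4(\lambda,\varphi)}$ ($\varphi\neq\frac{\pi}{2}$), $G_{4,4,2}$, with Lie algebra $\mathfrak g$. Then each nontrivial orbit $\Omega_F\subset\mathfrak g^*$ of the co-adjoint representation of $G$ admits a global diffeomorphism $\psi:\mathbb R^2\to\Omega_F$, $(p,q)\mapsto\psi(p,q)$, such that: (i) for every $A\in\mathfrak g$ the Hamiltonian function $\widetilde A(F')=\langle F',A\rangle$ ($F'\in\Omega_F$) is of the form $$\widetilde A\circ\psi(p,q)=\Phi(q)\,p+\Psi(q),$$ where $\Phi,\Psi$ (depending on $A$) are $C^\infty$-functions on $\mathbb R$; (ii) in the coordinates $(p,q)$ the Kirillov form of $\Omega_F$ is $\omega=dp\wedge dq$.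
   Context: Each group $G_{\bullet}$ is the connected and simply connected Lie group with the 4-dimensional real Lie algebra $\mathfrak g_{\bullet}$ with basis $X,Y,Z,T$ and the following brackets (brackets of basis elements not determined by the listed ones and antisymmetry are zero): - $\mathfrak g_{4,1,1}$: $[T,X]=Z$. - $\mathfrak g_{4,1,2}$: $[T,Z]=Z$. - $\mathfrak g_{4,2,1(\lambda)}$, $\lambda\in\mathbb R\setminus\{0\}$: $[T,Y]=\lambda Y$, $[T,Z]=Z$. - $\mathfrak g_{4,2,2}$: $[T,Y]=Y$, $[T,Z]=Y+Z$. - $\mathfrak g_{4,2,3(\varphi)}$, $\varphi\in(0,\pi)$: $[T,Y]=\cos\varphi\,Y-\sin\varphi\,Z$, $[T,Z]=\sin\varphi\,Y+\cos\varphi\,Z$. - $\mathfrak g_{4,3,1(\lambda_1,\lambda_2)}$, $\lambda_1,\lambda_2\in\mathbb R\setminus\{0\}$: $[T,X]=\lambda_1X$, $[T,Y]=\lambda_2Y$, $[T,Z]=Z$. - $\mathfrak g_{4,3,2(\lambda)}$, $\lambda\in\mathbb R\setminus\{0\}$: $[T,X]=\lambda X$, $[T,Y]=X+\lambda Y$, $[T,Z]=Z$. - $\mathfrak g_{4,3,3}$: $[T,X]=X$, $[T,Y]=X+Y$, $[T,Z]=Y+Z$. - $\mathfrak g_{4,3,4(\lambda,\varphi)}$, $\lambda\in\mathbb R\setminus\{0\}$, $\varphi\in(0,\pi)$: $[T,X]=\cos\varphi\,X-\sin\varphi\,Y$, $[T,Y]=\sin\varphi\,X+\cos\varphi\,Y$,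 $[T,Z]=\lambda Z$. - $\mathfrak g_{4,4,2}$: $[T,X]=-X$, $[T,Y]=Y$, $[X,Y]=Z$. The co-adjoint action $K$ of $G$ on $\mathfrak g^*$ is $\langle K(g)F,X\rangle=\langle F,\mathrm{Ad}(g^{-1})X\rangle$. $\Omega_F$ is the orbit of $F\in\mathfrak g^*$; an orbit is nontrivial if it is not a single point. For $A\in\mathfrak g$, $\xi_A$ is the vector field on $\Omega_F$ given by $(\xi_Af)(x)=\frac{d}{dt}f(x\exp(tA))|_{t=0}$, where $x\exp(tA)=K(\exp(-tA))x$. The Kirillov form $\omega$ on $\Omega_F$ is the 2-form determined at each $F'\in\Omega_F$ by $\omega_{F'}(\xi_A,\xi_B)=\langle F',[A,B]\rangle$ for all $A,B\in\mathfrak g$. *)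

(* Defs.v *)
From HB Require Import structures.
From mathcomp Require Import all_boot all_order all_algebra.
From mathcomp Require Import all_classical all_reals all_analysis.

Set Implicit Arguments.
Unset Strict Implicit.
Unset Printing Implicit Defensive.

Import Order.TTheory GRing.Theory Num.Theory.
Import numFieldNormedType.Exports.

Local Open Scope classical_set_scope.
Local Open Scope ring_scope.

(* C^k and C^oo maps on an open set U of a finite-dimensional space. *)
Fixpoint Ck_on (R : realType) (V W : normedModType R) (k : nat) (U : set V)
    (f : V -> W) : Prop :=
  match k with
  | 0 => forall x, U x -> {for x, continuous f}
  | k'.+1 => (forall x, U x -> differentiable f x) /\
             (forall v, Ck_on k' U ('D_v f))
  end.

Definition smooth_on (R : realType) (V W : normedModType R) (U : set V)
    (f : V -> W) : Prop :=
  forall k, Ck_on k U f.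

(* [chart_fun] is a homeomorphism from the open set [chart_dom] onto an open
   set, with inverse [chart_inv]; both are arbitrary outside of these sets. *)
Record chart (R : realType) (n : nat) (M : topologicalType) := Chart {
  chart_dom : set M;
  chart_fun :> M -> 'rV[R]_n.+1;
  chart_inv : 'rV[R]_n.+1 -> M;
  chart_dom_open : open chart_dom;
  chart_img_open : open (chart_fun @` chart_dom);
  chart_funK : forall x, chart_dom x -> chart_inv (chart_fun x) = x;
  chart_fun_continuous :
    forall x, chart_dom x -> {for x, continuous chart_fun};
  chart_inv_continuous :
    forall y, (chart_fun @` chart_dom) y -> {for y, continuous chart_inv} }.

Definition smooth_atlas (R : realType) (n : nat) (M : topologicalType)
    (atlas : set (chart R n M)) : Prop :=
  (forall x, exists2 c, atlas c & chart_dom c x) /\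
  (forall c d, atlas c -> atlas d ->
    smooth_on (c @` (chart_dom c `&` chart_dom d)) (d \o chart_inv c)).

#[short(type="preTopologicalGroupType")]
HB.structure Definition PreTopologicalGroup := {G of Topological G & Group G}.

(* Lie groups of dimension n.+1. *)
HB.mixin Record isLieGroup (R : realType) (n : nat) G
    of PreTopologicalGroup G := {
  lie_hausdorff : hausdorff_space G;
  lie_second_countable : @second_countable G;
  lie_atlas : set (chart R n G);
  lie_atlas_smooth : smooth_atlas lie_atlas;
  lie_mul_continuous : continuous (fun xy : G * G => (xy.1 * xy.2)%g);
  lie_mul_smooth : forall c1 c2 d : chart R n G,
    lie_atlas c1 -> lie_atlas c2 -> lie_atlas d ->
    smooth_on
      [set xy : 'rV[R]_n.+1 * 'rV[R]_n.+1 |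
        [/\ (c1 @` chart_dom c1) xy.1, (c2 @` chart_dom c2) xy.2 &
            chart_dom d (chart_inv c1 xy.1 * chart_inv c2 xy.2)%g]]
      (fun xy => d (chart_inv c1 xy.1 * chart_inv c2 xy.2)%g);
  lie_inv_continuous : continuous (fun x : G => (x^-1)%g);
  lie_inv_smooth : forall c d : chart R n G, lie_atlas c -> lie_atlas d ->
    smooth_on
      [set x : 'rV[R]_n.+1 |
        (c @` chart_dom c) x /\ chart_dom d ((chart_inv c x)^-1)%g]
      (fun x => d ((chart_inv c x)^-1)%g) }.

#[short(type="lieGroupType")]
HB.structure Definition LieGroup (R : realType) (n : nat) :=
  {G of isLieGroup R n G & PreTopologicalGroup G}.

(* Every loop is null-homotopic relative to its end points (connectedness is
   not included). *)
Definition simply_connected (R : realType) (M : topologicalType) : Prop :=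
  forall gamma : R -> M,
    {within `[0, 1], continuous gamma} -> gamma 0 = gamma 1 ->
    exists H : R * R -> M,
      [/\ {within `[0, 1] `*` `[0, 1], continuous H},
          forall t, t \in `[0, 1] -> H (0, t) = gamma t,
          forall t, t \in `[0, 1] -> H (1, t) = gamma 0 &
          forall s, s \in `[0, 1] -> H (s, 0) = gamma 0 /\ H (s, 1) = gamma 0].

Section LieAlgebra.
Variables (R : realType) (n : nat) (G : lieGroupType R n).
Local Notation E := 'rV[R]_n.+1.

(* For a chart c around 1, the tangent space of G at 1 is read as E. *)

Definition Ad_in_chart (c : chart R n G) (g : G) : E -> E :=
  'd (fun x : E => c (g * chart_inv c x * g^-1)%g) (c 1%g).

(* [A, B] is the derivative of h |-> Ad(h) B at 1 in the direction A. *)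
Definition bracket_in_chart (c : chart R n G) (A B : E) : E :=
  'D_A (fun x : E => Ad_in_chart c (chart_inv c x) B) (c 1%g).

(* An isomorphism from the Lie algebra (E, br) onto that of G: the element A
   corresponds to the tangent vector A *m iso_mx, read in iso_chart. *)
Record lie_algebra_iso (br : E -> E -> E) := LieAlgebraIso {
  iso_chart : chart R n G;
  iso_mx : 'M[R]_n.+1;
  iso_chart_atlas : lie_atlas iso_chart;
  iso_chart_dom1 : chart_dom iso_chart 1%g;
  iso_mx_unit : iso_mx \in unitmx;
  iso_bracket : forall A B,
    bracket_in_chart iso_chart (A *m iso_mx) (B *m iso_mx)
      = br A B *m iso_mx }.

Variables (br : E -> E -> E) (iota : lie_algebra_iso br).

Definition Ad (g : G) (A : E) : E :=
  Ad_in_chart (iso_chart iota) g (A *m iso_mx iota) *m invmx (iso_mx iota).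

(* A linear form F on the Lie algebra is given by its coordinates in the
   basis dual to the standard one. *)
Definition pairing (F A : E) : R := \sum_i F 0 i * A 0 i.

(* K(g) F is the linear form A |-> <F, Ad(g^-1) A>. *)
Definition coadjoint (g : G) (F : E) : E :=
  \row_i pairing F (Ad (g^-1)%g (delta_mx 0 i)).

Definition coadjoint_orbit (F : E) : set E :=
  [set coadjoint g F | g in [set: G]].

(* a is t |-> exp(tA). *)
Definition one_parameter_subgroup (a : R -> G) (A : E) : Prop :=
  [/\ forall s t, a (s + t) = (a s * a t)%g,
      continuous a,
      forall c : chart R n G, lie_atlas c ->
        smooth_on (a @^-1` chart_dom c) (c \o a) &
      is_derive (0 : R) (1 : R) (iso_chart iota \o a) (A *m iso_mx iota)].

(* v is the value at F of the vector field xi_A, i.e. the velocity at t = 0 of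
   F exp(tA) = K(exp(-tA)) F. *)
Definition fundamental_vector (A F v : E) : Prop :=
  exists2 a : R -> G, one_parameter_subgroup a A &
    is_derive (0 : R) (1 : R) (fun t => coadjoint (a (- t)) F) v.

(* omega F v w is the value of the form at F; its values are only constrained
   for F in Omega and v, w tangent to Omega, since the xi_A span the tangent
   spaces of an orbit. *)
Definition Kirillov_form (Omega : set E) (omega : E -> E -> E -> R) : Prop :=
  forall F A B v w, Omega F ->
    fundamental_vector A F v -> fundamental_vector B F w ->
    omega F v w = pairing F (br A B).

End LieAlgebra.

(* psi is a diffeomorphism from V onto the subset Omega of W: the inverse is
   smooth in the sense that it extends to a smooth map near each point. *)
Definition diffeomorphism_onto (R : realType) (V W : normedModType R)
    (Omega : set W) (psi : V -> W) : Prop :=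
  [/\ smooth_on [set: V] psi,
      set_bij [set: V] Omega psi &
      forall y, Omega y -> exists (U : set W) (phi : W -> V),
        [/\ open U, U y, smooth_on U phi &
            forall x, U (psi x) -> phi (psi x) = x]].

Inductive solvable4 (R : realType) : Type :=
  | G411
  | G412
  | G421 (lambda : R)
  | G422
  | G423 (phi : R)
  | G431 (lambda1 lambda2 : R)
  | G432 (lambda : R)
  | G433
  | G434 (lambda phi : R)
  | G442.

Arguments G411 {R}.
Arguments G412 {R}.
Arguments G422 {R}.
Arguments G433 {R}.
Arguments G442 {R}.

Definition admissible (R : realType) (L : solvable4 R) : Prop :=
  match L with
  | G421 l => l <> 0
  | G423 phi => 0 < phi < pi
  | G431 l1 l2 => l1 <> 0 /\ l2 <> 0
  | G432 l => l <> 0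
  | G434 l phi => l <> 0 /\ 0 < phi < pi
  | _ => True
  end.

Definition angle_not_right (R : realType) (L : solvable4 R) : Prop :=
  match L with
  | G423 phi | G434 _ phi => phi <> pi / 2
  | _ => True
  end.

(* The brackets [T,X], [T,Y], [T,Z], [X,Y], in this order, where (X, Y, Z, T)
   is the standard basis; [X,Z] and [Y,Z] vanish in all cases. *)
Definition basis_brackets (R : realType) (L : solvable4 R) :
    'rV[R]_4 * 'rV[R]_4 * 'rV[R]_4 * 'rV[R]_4 :=
  let X := delta_mx 0 0 in let Y := delta_mx 0 1 in let Z := delta_mx 0 2 in
  match L with
  | G411 => (Z, 0, 0, 0)
  | G412 => (0, 0, Z, 0)
  | G421 l => (0, l *: Y, Z, 0)
  | G422 => (0, Y, Y + Z, 0)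
  | G423 phi =>
      (0, cos phi *: Y - sin phi *: Z, sin phi *: Y + cos phi *: Z, 0)
  | G431 l1 l2 => (l1 *: X, l2 *: Y, Z, 0)
  | G432 l => (l *: X, X + l *: Y, Z, 0)
  | G433 => (X, X + Y, Y + Z, 0)
  | G434 l phi =>
      (cos phi *: X - sin phi *: Y, sin phi *: X + cos phi *: Y, l *: Z, 0)
  | G442 => (- X, Y, 0, Z)
  end.

Definition bracket4 (R : realType) (L : solvable4 R) (A B : 'rV[R]_4) :
    'rV[R]_4 :=
  let: (TX, TY, TZ, XY) := basis_brackets L in
  let minor (i j : 'I_4) := A 0 i * B 0 j - A 0 j * B 0 i in
  minor 3 0 *: TX + minor 3 1 *: TY + minor 3 2 *: TZ + minor 0 1 *: XY.

(* Main.v *)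
Require Import Defs.
From HB Require Import structures.
From mathcomp Require Import all_boot all_order all_algebra.
From mathcomp Require Import all_classical all_reals all_analysis.
From mathcomp Require Import ring lra.
Import Order.TTheory GRing.Theory Num.Theory.
Import numFieldNormedType.Exports.
Local Open Scope classical_set_scope.
Local Open Scope ring_scope.

(** At a linear form F the fundamental field xi_A takes the value F \o ad A, which
    is linear in F.  The proof writes down a surface psi : R * R -> g^* through F
    to which all the fields xi_A are tangent, and shows that this surface is the
    whole orbit ([leaf_orbit]).

    The orbit stays in the surface.  When h runs through a path in a chart around
    1, the point K(h^-1) F satisfies the linear equation k' = k \o ad (A s) with
    a continuous coefficient A ([coadjoint_curve_chart]).  A curve of this kind
    that starts on the surface stays on it, because the surface contains a
    solution of the same equation ([cylinder_curve]) or is cut out by functions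
    that are constant along it ([saddle_curve]).  As G is connected, this local
    statement is enough ([coadjoint_orbit_sub]).

    The orbit fills the surface.  In the coordinates (p, q) the map
    h |-> K(h^-1) (psi x) has a derivative at 1 that is onto, since the Kirillov
    form does not vanish on the surface; hence the orbit of psi x contains a
    neighbourhood of psi x in the surface ([coadjoint_orbit_near], from
    [local_surjectivity]).  The orbits thus cut the connected plane into open
    pieces, so that there is only one ([coadjoint_orbit_leaf]).

    For the surface, suppose that F vanishes on the brackets among X, Y and Z,
    which is automatic except for [X,Y] = Z in the last algebra.  Let
    q |-> (x, y, z) be the solution of u' = u \o ad T that starts at the values
    of F on X, Y and Z, and let p be the value on T ([cylinder]).  Then
    xi_T = d/dq and xi_X = - x' d/dp, so that (dp /\ dq)(xi_T, xi_X) = x' is the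
    value of the form on [T,X], and likewise for Y and Z.  The Hamiltonian
    functions are affine in p, with constant slopes.  The parametrization is
    injective with a smooth inverse because the time q can be read off the
    point: from an affine coordinate when ad T is nilpotent, and otherwise from
    the logarithm of a coordinate, or of the radius of a spiral, that is
    multiplied by e^(m q) with m <> 0.  On a spiral m is cos phi, which is where
    phi <> pi / 2 enters: at pi / 2 the curve closes up.

    In the last algebra, when F does not vanish on Z, the orbit is the quadric
    x y - z t = const inside z = const, where t is the value on T.  Taking
    x = z p and y = q makes t affine in p, and the Kirillov form dp /\ dq
    ([saddle]). *)

Set Implicit Arguments.
Unset Strict Implicit.
Unset Printing Implicit Defensive.

(** * Maps of class C^k *)

Lemma near_eq_is_diff (R : realType) (V W : normedModType R) (f g df : V -> W)
    (x : V) : (\near x, f x = g x) -> is_diff x f df -> is_diff x g df.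
Proof.
move=> fg [dif fE].
have [fc fo] := (diff_locallyP _ _).1 dif.
have go : g \o shift x = cst (g x) + 'd f x +o_ 0 id.
  apply/eqaddoP => e e0.
  have fg0 : \forall y \near 0, f (y + x) = g (y + x).
    by move: fg; rewrite (near_shift 0 x) subr0; apply: filterS => y /=.
  move/eqaddoP : fo => /(_ e e0); apply: filterS2 fg0 => y.
  by rewrite !fctE /= => ->; rewrite (nbhs_singleton fg).
have gE := diff_unique fc go.
by split; [apply/diff_locallyP; rewrite gE; split|rewrite gE].
Qed.

Lemma is_diff_scale (R : realType) (V W : normedModType R) (a da : V -> R)
    (f df : V -> W) (x : V) : is_diff x a da -> is_diff x f df ->
  is_diff x (fun y => a y *: f y) (fun v => a x *: df v + da v *: f x).
Proof.
move=> ax fx.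
have scale_bilin : bilinear_for
    (GRing.Scale.Law.clone _ _ *:%R _) (GRing.Scale.Law.clone _ _ *:%R _)
    (fun (r : R) (w : W) => r *: w).
  split=> [u'|u] r y z /=; first by rewrite scalerDl scalerA.
  by rewrite scalerDr !scalerA mulrC.
pose m := bilinear_isBilinear.Build R R W W _ _ _ scale_bilin.
pose B : {bilinear R -> W -> W} := HB.pack (fun (r : R) (w : W) => r *: w) m.
have cB : continuous (fun p : R * W => B p.1 p.2).
  exact: (@scale_continuous R W).
have dB p : is_diff p (fun q : R * W => q.1 *: q.2)
    (fun q => p.1 *: q.2 + q.1 *: p.2).
  by split; [exact: (@differentiable_bilin _ _ _ _ B p cB)|
             exact: (diff_bilin p cB)].
exact: (@is_diff_comp _ _ _ _ (fun y => (a y, f y)) (fun v => (da v, df v))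
  (fun q : R * W => q.1 *: q.2)).
Qed.

Lemma is_diffE (R : realType) (V W : normedModType R) (f df : V -> W) (x v : V) :
  is_diff x f df -> 'D_v f x = df v.
Proof. by move=> [dif <-]; rewrite deriveE. Qed.

Lemma is_diff_linear (R : realType) (V W : normedModType R)
    (f : {linear V -> W}) (x : V) : continuous f -> is_diff x f f.
Proof. by move=> fc; split; [exact: linear_differentiable|rewrite diff_lin]. Qed.

Section Ck.
Variable R : realType.
Implicit Types V W X : normedModType R.

Lemma Ck_ext V W k (U : set V) (f g : V -> W) : open U ->
  (forall x, U x -> f x = g x) -> Ck_on k U f -> Ck_on k U g.
Proof.
move=> oU; elim: k f g => [|k IH] f g fg /=.
  move=> fc x Ux; have fx : f @ x --> g x by rewrite -fg//; exact: fc.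
  apply: cvg_trans fx; apply: near_eq_cvg.
  by apply: filterS (open_nbhs_nbhs (conj oU Ux)) => y /fg ->.
move=> [df Df]; have fgx x : U x -> \near x, f x = g x.
  by move=> Ux; apply: filterS (open_nbhs_nbhs (conj oU Ux)).
split=> [x Ux|v].
  by have [] := near_eq_is_diff (fgx x Ux) (differentiableP (df x Ux)).
by apply: IH (Df v) => x Ux; apply: near_eq_derive; exact: fgx.
Qed.

Lemma CkW V W k (U : set V) (f : V -> W) : Ck_on k.+1 U f -> Ck_on k U f.
Proof.
elim: k f => [|k IH] f [df Df].
  by move=> x Ux; apply: differentiable_continuous; exact: df.
by split=> // v; exact: IH.
Qed.

Lemma Ck_sub V W k (U U' : set V) (f : V -> W) :
  U `<=` U' -> Ck_on k U' f -> Ck_on k U f.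
Proof.
move=> UU'; elim: k f => [|k IH] f /=; first by move=> h x /UU'; exact: h.
by move=> [df Df]; split=> [x /UU'|v]; [exact: df|exact: IH].
Qed.

Lemma Ck_continuous V W k (U : set V) (f : V -> W) x : Ck_on k U f -> U x ->
  {for x, continuous f}.
Proof. by elim: k => [|k IH] Hf Ux; [exact: Hf|apply: IH => //; exact: CkW]. Qed.

(** The differential may be given by any formula that holds on U, which is then
    differentiated in its turn. *)
Lemma CkS V W k (U : set V) (f : V -> W) (df : V -> V -> W) : open U ->
  (forall x, U x -> is_diff x f (df x)) ->
  (forall v, Ck_on k U (df ^~ v)) -> Ck_on k.+1 U f.
Proof.
move=> oU fD dfk; split=> [x /fD []//|v].
by apply: Ck_ext (dfk v) => // x /fD /is_diffE ->.
Qed.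

Lemma Ck_diff V W k (U : set V) (f : V -> W) x : Ck_on k.+1 U f -> U x ->
  is_diff x f (fun v => 'D_v f x).
Proof.
move=> [df _] Ux; split; first exact: df.
by apply/funext => v; rewrite deriveE//; exact: df.
Qed.

Lemma Ck_cst V W k (U : set V) (w : W) : Ck_on k U (fun=> w).
Proof.
elim: k w => [|k IH] w /=; first by move=> x _; exact: cvg_cst.
split=> [x _|v]; first exact: differentiable_cst.
rewrite (_ : 'D_v _ = (fun=> 0))//.
by apply/funext => x; exact: derive_cst.
Qed.

Lemma Ck_linear V W k (U : set V) (f : {linear V -> W}) : open U ->
  continuous f -> Ck_on k U f.
Proof.
move=> oU fc; case: k => [|k]; first by move=> x _; exact: fc.
apply: (@CkS _ _ _ _ _ (fun=> f)) => // [x _|v]; first exact: is_diff_linear.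
exact: Ck_cst.
Qed.

Lemma CkD V W k (U : set V) (f g : V -> W) : open U ->
  Ck_on k U f -> Ck_on k U g -> Ck_on k U (fun x => f x + g x).
Proof.
move=> oU; elim: k f g => [|k IH] f g Hf Hg.
  by move=> x Ux; apply: cvgD; [exact: Hf|exact: Hg].
apply: (@CkS _ _ _ _ _ (fun x v => 'D_v f x + 'D_v g x)) => // [x Ux|v].
  have df := Ck_diff Hf Ux; have dg := Ck_diff Hg Ux.
  exact: is_diffD.
by apply: IH; [case: Hf => _; apply|case: Hg => _; apply].
Qed.

Lemma Ck_sum V W k (U : set V) (I : Type) (r : seq I) (f : I -> V -> W) :
  open U -> (forall i, Ck_on k U (f i)) ->
  Ck_on k U (fun x => \sum_(i <- r) f i x).
Proof.
move=> oU Hf; elim: r => [|i r IH].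
  by apply: Ck_ext (Ck_cst _ _ 0) => // x _; rewrite big_nil.
by apply: Ck_ext (CkD oU (Hf i) IH) => // x _; rewrite big_cons.
Qed.

Lemma Ck_linear_comp V W X k (U : set V) (l : {linear W -> X}) (f : V -> W) :
  open U -> continuous l -> Ck_on k U f -> Ck_on k U (fun x => l (f x)).
Proof.
move=> oU lc; elim: k f => [|k IH] f Hf.
  by move=> x Ux; apply: (continuous_comp (Hf x Ux)); exact: lc.
apply: (@CkS _ _ _ _ _ (fun x v => l ('D_v f x))) => // [x Ux|v].
  have df := Ck_diff Hf Ux.
  have dl := is_diff_linear (f x) lc; exact: is_diff_comp.
by apply: IH; case: Hf => _; apply.
Qed.

Lemma Ck_scale V W k (U : set V) (a : V -> R) (f : V -> W) : open U ->
  Ck_on k U a -> Ck_on k U f -> Ck_on k U (fun x => a x *: f x).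
Proof.
move=> oU; elim: k a f => [|k IH] a f Ha Hf.
  by move=> x Ux; apply: cvgZ; [exact: Ha|exact: Hf].
apply: (@CkS _ _ _ _ _ (fun x v => a x *: 'D_v f x + 'D_v a x *: f x)) =>
    // [x Ux|v].
  have da := Ck_diff Ha Ux; have df := Ck_diff Hf Ux.
  exact: is_diff_scale.
apply: CkD => //; apply: IH; [exact: CkW| | |exact: CkW].
  by case: Hf => _; apply.
by case: Ha => _; apply.
Qed.

Lemma CkM V k (U : set V) (a b : V -> R) : open U ->
  Ck_on k U a -> Ck_on k U b -> Ck_on k U (fun x => a x * b x).
Proof. by move=> oU Ha Hb; exact: (Ck_scale oU Ha Hb). Qed.

Lemma Ck_pair V W X k (U : set V) (f : V -> W) (g : V -> X) : open U ->
  Ck_on k U f -> Ck_on k U g -> Ck_on k U (fun x => (f x, g x)).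
Proof.
move=> oU; elim: k f g => [|k IH] f g Hf Hg.
  by move=> x Ux; apply: cvg_pair; [exact: Hf|exact: Hg].
apply: (@CkS _ _ _ _ _ (fun x v => ('D_v f x, 'D_v g x))) => // [x Ux|v].
  have df := Ck_diff Hf Ux; have dg := Ck_diff Hg Ux.
  exact: is_diff_pair.
by apply: IH; [case: Hf => _; apply|case: Hg => _; apply].
Qed.

(** The iterated chain rule needs a basis: D_v (g \o f) is the derivative of g in
    the direction D_v f, which moves with the point, and has to be expanded along
    fixed directions before it can be differentiated again. *)
Definition finite_frame W : Prop := exists (I : finType) (e : I -> W)
  (l : I -> {linear W -> R}),
  (forall i, continuous (l i)) /\ forall w, w = \sum_i l i w *: e i.

(** Induction on k: D_v (g \o f) is the sum of the products of a coordinate of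
    D_v f and D_(e i) g \o f, all of which lose one derivative only. *)
Lemma Ck_comp V W X k (U : set V) (U' : set W) (f : V -> W) (g : W -> X) :
  finite_frame W -> open U -> open U' -> (forall x, U x -> U' (f x)) ->
  Ck_on k U f -> Ck_on k U' g -> Ck_on k U (fun x => g (f x)).
Proof.
move=> [I [e [l [lc eE]]]] oU oU' UU'; elim: k g => [|k IH] g Hf Hg.
  by move=> x Ux; apply: (continuous_comp (Hf x Ux)); exact/Hg/UU'.
apply: (@CkS _ _ _ _ _
    (fun x v => \sum_i l i ('D_v f x) *: 'D_(e i) g (f x))) => // [x Ux|v].
  have df := Ck_diff Hf Ux; have dg := Ck_diff Hg (UU' x Ux).
  have := is_diff_comp df dg; congr is_diff_def; apply/funext => v /=.
  have [dig _] := dg; rewrite deriveE// [in LHS](eE ('D_v f x)) linear_sum.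
  by apply: eq_bigr => i _; rewrite linearZ -deriveE.
apply: Ck_sum => // i; apply: Ck_scale => //.
  by apply: Ck_linear_comp => //; case: Hf => _; apply.
by apply: (IH ('D_(e i) g)); [exact: CkW|have [_] := Hg; apply].
Qed.

End Ck.

Section Frames.
Variable R : realType.

Lemma frame_real : finite_frame (R : normedModType R).
Proof.
exists unit, (fun=> 1), (fun=> idfun); split=> [_ x|w]; first exact: cvg_id.
by rewrite (bigD1 tt)//= big1 ?addr0 => [|[]//]; exact/esym/mulr1.
Qed.

Lemma coord_linear n (i : 'I_n.+1) : linear (fun w : 'rV[R]_n.+1 => w 0 i).
Proof. by move=> a u v; rewrite !mxE. Qed.

Definition coordL n (i : 'I_n.+1) : {linear 'rV[R]_n.+1 -> R} :=
  HB.pack (fun w : 'rV[R]_n.+1 => w 0 i)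
    (GRing.isLinear.Build _ _ _ _ _ (@coord_linear n i)).

Lemma coordL_continuous n (i : 'I_n.+1) : continuous (coordL i).
Proof. exact: coord_continuous. Qed.

Lemma frame_row n : finite_frame ('rV[R]_n.+1 : normedModType R).
Proof.
exists 'I_n.+1, (fun i => delta_mx 0 i), (@coordL n).
split=> [i|w]; first exact: coordL_continuous.
exact: row_sum_delta.
Qed.

Lemma frame_prod (V W : normedModType R) :
  finite_frame V -> finite_frame W ->
  finite_frame ((V * W)%type : normedModType R).
Proof.
move=> [I [e [l [lc eE]]]] [J [e' [l' [lc' eE']]]].
pose lv i : {linear (V * W)%type -> R} := l i \o fst.
pose lw j : {linear (V * W)%type -> R} := l' j \o snd.
exists (I + J)%type, (fun s => match s with
  | inl i => (e i, 0) | inr j => (0, e' j) end),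
  (fun s => match s with
  | inl i => lv i
  | inr j => lw j end).
split=> [[i|j] x|w].
- by apply: continuous_comp; [exact: cvg_fst|exact: lc].
- by apply: continuous_comp; [exact: cvg_snd|exact: lc'].
rewrite big_sumType /=; case: w => v w /=.
rewrite [in LHS](eE v) [in LHS](eE' w).
have -> : \sum_i l i v *: (e i, 0 : W) = (\sum_i l i v *: e i, 0).
  elim/big_ind2: _ => // [a b c d -> ->|i _].
    by congr pair; rewrite addr0.
  by congr pair; rewrite scaler0.
have -> : \sum_i l' i w *: (0 : V, e' i) = (0, \sum_i l' i w *: e' i).
  elim/big_ind2: _ => // [a b c d -> ->|i _].
    by congr pair; rewrite addr0.
  by congr pair; rewrite scaler0.
by congr pair; rewrite ?addr0 ?add0r.
Qed.

End Frames.

(** * Elementary functions and coordinates *)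

Lemma is_derive_diff (R : realType) (W : normedModType R) (f : R -> W) (x : R)
    (d : W) : is_derive x 1 f d -> is_diff x f (fun v => v *: d).
Proof.
move=> [fx <-]; split; first exact/derivable1_diffP.
by rewrite deriv1E// derive1E.
Qed.

Lemma is_diff_derive (R : realType) (V W : normedModType R) (f df : V -> W)
    (x v : V) : is_diff x f df -> is_derive x v f (df v).
Proof.
move=> fx; split; last exact: is_diffE.
by case: fx => /diff_derivable.
Qed.

Lemma is_derive_along (R : realType) (V W : normedModType R) (f df : V -> W)
    (g : R -> V) (s : R) (v : V) : is_derive s 1 g v -> is_diff (g s) f df ->
  is_derive s 1 (f \o g) (df v).
Proof.
move=> /is_derive_diff gs fs.
by have := is_diff_derive (1 : R) (is_diff_comp gs fs); rewrite /= scale1r.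
Qed.

Section MoreCk.
Variable R : realType.
Implicit Types V W X : normedModType R.

Lemma Ck_id V k (U : set V) : open U -> Ck_on k U id.
Proof. by move=> oU; apply: (@Ck_linear _ _ _ _ _ idfun) => // x; exact: cvg_id. Qed.

Lemma Ck_fst V W k (U : set (V * W)) : open U -> Ck_on k U fst.
Proof. by move=> oU; apply: (@Ck_linear _ _ _ _ _ fst) => // x; exact: cvg_fst. Qed.

Lemma Ck_snd V W k (U : set (V * W)) : open U -> Ck_on k U snd.
Proof. by move=> oU; apply: (@Ck_linear _ _ _ _ _ snd) => // x; exact: cvg_snd. Qed.

Lemma Ck_coord V n k (U : set V) (f : V -> 'rV[R]_n.+1) i : open U ->
  Ck_on k U f -> Ck_on k U (fun x => f x 0 i).
Proof.
move=> oU; apply: (@Ck_linear_comp _ _ _ _ _ _ (coordL R i)) => //.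
exact: coordL_continuous.
Qed.

Lemma Ck_row V n k (U : set V) (f : V -> 'rV[R]_n.+1) : open U ->
  (forall i, Ck_on k U (fun x => f x 0 i)) -> Ck_on k U f.
Proof.
move=> oU Hf.
apply: (@Ck_ext _ _ _ _ _ (fun x => \sum_i f x 0 i *: delta_mx 0 i)) => //.
  by move=> x _; rewrite -row_sum_delta.
by apply: Ck_sum => // i; apply: Ck_scale => //; exact: Ck_cst.
Qed.

Lemma CkS_real k (U : set R) (f f' : R -> R) : open U ->
  (forall x, U x -> is_derive x 1 f (f' x)) -> Ck_on k U f' -> Ck_on k.+1 U f.
Proof.
move=> oU fD Hf'; apply: (@CkS _ R R _ _ _ (fun x v => v * f' x)) => [||v].
- exact: oU.
- by move=> x Ux; exact/is_derive_diff/fD.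
by apply: CkM => //; exact: Ck_cst.
Qed.

Lemma Ck_expR V k (U : set V) (f : V -> R) : open U -> Ck_on k U f ->
  Ck_on k U (fun x => expR (f x)).
Proof.
move=> oU Hf; apply: (Ck_comp (frame_real R) oU openT _ Hf) => //.
elim: k {Hf} => [|k IH]; first by move=> x _; exact: continuous_expR.
by apply: (CkS_real openT) IH => x _; exact: is_derive_expR.
Qed.

Lemma CkN V W k (U : set V) (f : V -> W) : open U -> Ck_on k U f ->
  Ck_on k U (fun x => - f x).
Proof.
move=> oU Hf; apply: Ck_ext (Ck_scale oU (Ck_cst _ _ (-1 : R)) Hf) => // x _.
by rewrite scaleN1r.
Qed.

(** The induction on k carries cos and sin together, as each is the derivative of
    the other up to sign. *)
Lemma Ck_trigo V k (U : set V) (f : V -> R) : open U -> Ck_on k U f ->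
  Ck_on k U (fun x => cos (f x)) /\ Ck_on k U (fun x => sin (f x)).
Proof.
move=> oU Hf.
suff [Hc Hs] : Ck_on k [set: R] cos /\ Ck_on k [set: R] sin.
  by split; exact: (Ck_comp (frame_real R) oU openT _ Hf).
elim: k {Hf} => [|k [IHc IHs]].
  by split=> x _; [exact: continuous_cos|exact: continuous_sin].
split; last by apply: (CkS_real openT) IHc => x _; exact: is_derive_sin.
apply: (CkS_real openT) (CkN openT IHs) => x _; exact: is_derive_cos.
Qed.

Lemma Ck_inv V k (U : set V) (f : V -> R) : open U ->
  (forall x, U x -> f x != 0) -> Ck_on k U f -> Ck_on k U (fun x => (f x)^-1).
Proof.
move=> oU; elim: k => [|k IH] f0 Hf.
  by move=> x Ux; apply: cvgV; [exact: f0|exact: Hf].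
apply: (@CkS _ _ _ _ _ _ (fun x v => - ((f x)^-1 * (f x)^-1) * 'D_v f x)) => //.
  move=> x Ux; have dfx := Ck_diff Hf Ux; have [dif _] := dfx.
  split; first by apply: differentiableV => //; exact: f0.
  rewrite (diffV dif (f0 x Ux)).
  apply/funext => v /=; rewrite -deriveE//.
  by rewrite expr2 invfM.
move=> v; apply: CkM => //; last by have [_] := Hf; apply.
by apply: CkN => //; apply: CkM => //; apply: IH => //; exact: CkW.
Qed.

Lemma Ck_ln V k (U : set V) (f : V -> R) : open U ->
  (forall x, U x -> 0 < f x) -> Ck_on k U f -> Ck_on k U (fun x => ln (f x)).
Proof.
have oP : open [set x : R | 0 < x] by exact: open_gt.
move=> oU f0 Hf; apply: (Ck_comp (frame_real R) oU oP f0 Hf) => //.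
case: k {Hf} => [|k]; first by move=> x /=; exact: continuous_ln.
apply: (@CkS_real _ _ _ (fun x => x^-1) oP) => //.
by apply: Ck_inv => //; [move=> x /= /lt0r_neq0|exact: Ck_id].
Qed.

End MoreCk.

Lemma open_setI_preimage (T T' : topologicalType) (U : set T) (U' : set T')
    (f : T -> T') : open U -> open U' ->
  (forall x, U x -> {for x, continuous f}) -> open [set x | U x /\ U' (f x)].
Proof.
move=> oU oU' fc; rewrite openE => x [Ux U'x].
apply: filterI; first exact: open_nbhs_nbhs.
exact/(fc x Ux)/open_nbhs_nbhs.
Qed.

Lemma continuous_pair_at (T U V : topologicalType) (f : T -> U) (g : T -> V)
    (x : T) : {for x, continuous f} -> {for x, continuous g} ->
  {for x, continuous (fun y => (f y, g y))}.
Proof. by move=> fx gx; apply: cvg_pair; [exact: fx|exact: gx]. Qed.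

(** * The adjoint representation in charts *)

Section LieGroup.
Variables (R : realType) (n : nat) (G : lieGroupType R n).
Local Notation E := 'rV[R]_n.+1.
Implicit Types c d : chart R n G.

Definition mul_dom c1 c2 d : set (E * E) :=
  [set xy | [/\ (c1 @` chart_dom c1) xy.1, (c2 @` chart_dom c2) xy.2 &
            chart_dom d (chart_inv c1 xy.1 * chart_inv c2 xy.2)%g]].

Definition mul_chart c1 c2 d (xy : E * E) : E :=
  d (chart_inv c1 xy.1 * chart_inv c2 xy.2)%g.

Definition inv_dom c : set E :=
  [set x | (c @` chart_dom c) x /\ chart_dom c ((chart_inv c x)^-1)%g].

Definition inv_chart c (x : E) : E := c ((chart_inv c x)^-1)%g.

Lemma open_mul_dom c1 c2 d : open (mul_dom c1 c2 d).
Proof.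
have -> : mul_dom c1 c2 d =
    [set xy | ((fst @^-1` (c1 @` chart_dom c1)) `&`
               (snd @^-1` (c2 @` chart_dom c2))) xy /\
      chart_dom d ((fun g : G * G => (g.1 * g.2)%g)
        (chart_inv c1 xy.1, chart_inv c2 xy.2))].
  by apply/seteqP; split => -[x y] /=; [move=> []|move=> [[]]].
apply: (@open_setI_preimage _ _ _ _ (fun xy : E * E =>
   ((fun g : G * G => (g.1 * g.2)%g) (chart_inv c1 xy.1, chart_inv c2 xy.2)))).
- apply: openI.
    by apply: open_comp; [move=> x _; exact: cvg_fst|exact: chart_img_open].
  by apply: open_comp; [move=> x _; exact: cvg_snd|exact: chart_img_open].
- exact: chart_dom_open.
move=> xy [/= h1 h2].
apply: (@continuous_comp _ _ _
  (fun xy : E * E => (chart_inv c1 xy.1, chart_inv c2 xy.2))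
  (fun g : G * G => (g.1 * g.2)%g)); last exact: lie_mul_continuous.
apply: continuous_pair_at.
  apply: (@continuous_comp _ _ _ fst (chart_inv c1)); first exact: cvg_fst.
  exact: chart_inv_continuous.
apply: (@continuous_comp _ _ _ snd (chart_inv c2)); first exact: cvg_snd.
exact: chart_inv_continuous.
Qed.

Lemma open_inv_dom c : open (inv_dom c).
Proof.
apply: (@open_setI_preimage _ _ _ _ (fun x : E => (chart_inv c x)^-1%g)).
- exact: chart_img_open.
- exact: chart_dom_open.
move=> x hx; apply: (@continuous_comp _ _ _ (chart_inv c) (fun g : G => g^-1%g)).
  exact: chart_inv_continuous.
exact: lie_inv_continuous.
Qed.

Lemma mul_chart_diff c1 c2 d xy : lie_atlas c1 -> lie_atlas c2 ->
  lie_atlas d -> mul_dom c1 c2 d xy -> differentiable (mul_chart c1 c2 d) xy.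
Proof.
by move=> h1 h2 hd hxy; have [+ _] := lie_mul_smooth c1 c2 d h1 h2 hd 1%N; apply.
Qed.

Section Conjugation.
Variable c : chart R n G.
Hypotheses (cA : lie_atlas c) (c1 : chart_dom c 1%g).

Let e := c 1%g.

Lemma chart_unit_img : (c @` chart_dom c) e. Proof. by exists 1%g. Qed.

Lemma chart_inv_unit : chart_inv c e = 1%g. Proof. exact: chart_funK. Qed.

Definition conj_chart (g : G) (x : E) : E := c (g * chart_inv c x * g^-1)%g.

Lemma conj_chart_unit g : conj_chart g e = e.
Proof. by rewrite /conj_chart chart_inv_unit mulg1 mulgV. Qed.

Lemma near_unit_img : \near e, (c @` chart_dom c) e.
Proof.
by apply: open_nbhs_nbhs; split; [exact: chart_img_open|exact: chart_unit_img].
Qed.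

Lemma conj_chart_dom g : \near e, chart_dom c (g * chart_inv c e * g^-1)%g.
Proof.
have : {for e, continuous (fun x => (g * chart_inv c x * g^-1)%g)}.
  have mc (a b : E -> G) : {for e, continuous a} -> {for e, continuous b} ->
      {for e, continuous (fun x => (a x * b x)%g)}.
    move=> ac bc; apply: (@continuous_comp _ _ _ (fun x => (a x, b x))
      (fun g : G * G => (g.1 * g.2)%g)); last exact: lie_mul_continuous.
    by apply: continuous_pair_at; [exact: ac|exact: bc].
  apply: (mc (fun x => (g * chart_inv c x)%g)); last exact: cst_continuous.
  apply: mc; first exact: cst_continuous.
  by apply: chart_inv_continuous; exact: chart_unit_img.
apply; apply: open_nbhs_nbhs; split; first exact: chart_dom_open.
by rewrite chart_inv_unit mulg1 mulgV.
Qed.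

(** The elements g and g^-1 may be far from 1, so that the two products are read
    through charts around g and around g^-1; in c only the factor near 1 and the
    final result are read. *)
Lemma conj_chart_differentiable g : differentiable (conj_chart g) e.
Proof.
have [[c1' A1 D1] [c2 A2 D2]] :=
  (proj1 (lie_atlas_smooth (s := G)) g, proj1 (lie_atlas_smooth (s := G)) g^-1%g).
have gE : chart_inv c1' (c1' g) = g by exact: chart_funK.
have gVE : chart_inv c2 (c2 g^-1%g) = g^-1%g by exact: chart_funK.
pose f1 (x : E) := mul_chart c1' c c1' (c1' g, x).
pose f2 (y : E) := mul_chart c1' c2 c (y, c2 g^-1%g).
have m1 : mul_dom c1' c c1' (c1' g, e).
  split=> /=; [by exists g|exact: chart_unit_img|].
  by rewrite gE chart_inv_unit mulg1.
have m2 : mul_dom c1' c2 c (f1 e, c2 g^-1%g).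
  rewrite /f1 /mul_chart /= gE chart_inv_unit mulg1.
  by split=> /=; [exists g|exists g^-1%g|rewrite gE gVE mulgV].
have pairl (a x : E) : is_diff x (fun y => (a, y)) (fun y => (0, y)).
  exact: (is_diff_pair (is_diff_cst _ _) (is_diff_id _)).
have pairr (a x : E) : is_diff x (fun y => (y, a)) (fun y => (y, 0)).
  exact: (is_diff_pair (is_diff_id _) (is_diff_cst _ _)).
have df1 : differentiable f1 e.
  apply: (@differentiable_comp _ _ _ _ (fun x => (c1' g, x))) => //.
  exact: mul_chart_diff.
have df2 : differentiable f2 (f1 e).
  apply: (@differentiable_comp _ _ _ _ (fun x => (x, c2 g^-1%g))) => //.
  exact: mul_chart_diff.
have df := differentiable_comp df1 df2.
have pc : {for e, continuous (fun x : E => (c1' g, x))}.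
  by apply: continuous_pair_at; [exact: cst_continuous|by move=> ?].
have fE : \near e, (f2 \o f1) e = conj_chart g e.
  have hn : nbhs e [set x | mul_dom c1' c c1' (c1' g, x)].
    exact: (pc _ (open_nbhs_nbhs (conj (@open_mul_dom _ _ _) m1))).
  apply: filterS hn => x [/= _ _]; rewrite gE => h.
  by rewrite /f2 /f1 /conj_chart /mul_chart /= gE gVE chart_funK.
by have [] := near_eq_is_diff fE (differentiableP df).
Qed.

Lemma Ad_in_chartE g : Ad_in_chart c g = 'd (conj_chart g) e :> (E -> E).
Proof. by []. Qed.

Lemma Ad_in_chartM g h v :
  Ad_in_chart c (g * h)%g v = Ad_in_chart c g (Ad_in_chart c h v).
Proof.
have dg := conj_chart_differentiable g; have dh := conj_chart_differentiable h.
have dg' : differentiable (conj_chart g) (conj_chart h e).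
  by rewrite conj_chart_unit.
have [] := @near_eq_is_diff _ _ _ _ (conj_chart (g * h)%g) _ e _
  (is_diff_comp (differentiableP dh) (differentiableP dg')).
  apply: filterS (conj_chart_dom h) => x hx.
  by rewrite /conj_chart /= chart_funK// invgM !mulgA.
move=> _ dE; apply: (eq_trans (congr1 (fun f : E -> E => f v) dE)).
rewrite /comp (conj_chart_unit h); reflexivity.
Qed.

Lemma Ad_in_chart1 v : Ad_in_chart c 1%g v = v.
Proof.
have [] := @near_eq_is_diff _ _ _ id (conj_chart 1%g) _ e _ (is_diff_id e).
  apply: filterS near_unit_img => x [g dg <-].
  by rewrite /conj_chart mul1g invg1 mulg1 chart_funK.
by move=> _ dE; exact: (congr1 (fun f : E -> E => f v) dE).
Qed.

Lemma Ad_in_chart_linear g : linear (Ad_in_chart c g).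
Proof. by move=> a u v; rewrite !Ad_in_chartE linearP. Qed.

Definition conj_dom : set (E * E) := [set xy | mul_dom c c c xy /\
  inv_dom c xy.1 /\ mul_dom c c c (mul_chart c c c xy, inv_chart c xy.1)].

(** Conjugation with both the conjugating and the conjugated element near 1.  Ad is
    its partial derivative in the second variable, so that its smoothness gives
    that of h |-> Ad h. *)
Definition conj2 (xy : E * E) : E :=
  mul_chart c c c (mul_chart c c c xy, inv_chart c xy.1).

Let inv_fst_dom : set (E * E) := mul_dom c c c `&` (fst @^-1` inv_dom c).

Let open_inv_fst_dom : open inv_fst_dom.
Proof.
apply: openI; first exact: open_mul_dom.
by apply: open_comp; [move=> x _; exact: cvg_fst|exact: open_inv_dom].
Qed.

Let Ck_conj_arg k :
  Ck_on k inv_fst_dom (fun xy => (mul_chart c c c xy, inv_chart c xy.1)).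
Proof.
apply: (Ck_pair open_inv_fst_dom).
  apply: (@Ck_sub _ _ _ _ _ (mul_dom c c c)); first by move=> ? [].
  exact: lie_mul_smooth.
apply: (@Ck_comp _ _ _ _ _ _ (inv_dom c) fst (inv_chart c)).
- exact: frame_row.
- exact: open_inv_fst_dom.
- exact: open_inv_dom.
- by move=> xy [].
- exact: (Ck_fst _ open_inv_fst_dom).
- exact: lie_inv_smooth.
Qed.

Let conj_domE : conj_dom = [set xy | inv_fst_dom xy /\
  mul_dom c c c (mul_chart c c c xy, inv_chart c xy.1)].
Proof.
by apply/seteqP; split => xy; [move=> [? []]|move=> [[]]].
Qed.

Lemma open_conj_dom : open conj_dom.
Proof.
rewrite conj_domE; apply: (open_setI_preimage open_inv_fst_dom).
  exact: open_mul_dom.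
by move=> x; apply: (Ck_continuous (Ck_conj_arg 0)).
Qed.

Lemma Ck_conj2 k : Ck_on k conj_dom conj2.
Proof.
apply: (@Ck_comp _ _ _ _ _ _ (mul_dom c c c)
  (fun xy => (mul_chart c c c xy, inv_chart c xy.1))).
- by apply: frame_prod; exact: frame_row.
- exact: open_conj_dom.
- exact: open_mul_dom.
- by move=> xy [_ []].
- by rewrite conj_domE; apply: Ck_sub (Ck_conj_arg k) => xy [].
- exact: lie_mul_smooth.
Qed.

Lemma conj2E x y : conj_dom (x, y) ->
  conj2 (x, y) = conj_chart (chart_inv c x) y.
Proof.
move=> [[_ _ hxy] [[_ hx] _]].
by rewrite /conj2 /mul_chart /inv_chart /conj_chart /= !chart_funK.
Qed.

Definition Ad_dom : set E := [set x | conj_dom (x, e)].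

Lemma open_Ad_dom : open Ad_dom.
Proof.
apply: (@open_comp _ _ (fun x => (x, e))); last exact: open_conj_dom.
by move=> x _; apply: (@continuous_pair_at E E E idfun (fun=> e));
  [move=> ?|exact: cst_continuous].
Qed.

Lemma Ad_dom_unit : Ad_dom e.
Proof.
have V1 : (1%g : G)^-1%g = 1%g by exact: invg1.
have mE : mul_chart c c c (e, e) = e.
  by rewrite /mul_chart /= chart_inv_unit mulg1.
have iE : inv_chart c e = e by rewrite /inv_chart chart_inv_unit V1.
have me : mul_dom c c c (e, e).
  split=> /=; [exact: chart_unit_img|exact: chart_unit_img|].
  by rewrite chart_inv_unit mulg1.
split=> //; split; last by rewrite mE iE.
by split; [exact: chart_unit_img|rewrite chart_inv_unit V1].
Qed.

Lemma Ad_domE x v : Ad_dom x ->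
  Ad_in_chart c (chart_inv c x) v = 'D_(0, v) conj2 (x, e).
Proof.
move=> hx; have d2 := Ck_diff (Ck_conj2 1) hx.
have dp : is_diff e (fun y => (x, y)) (fun y : E => (0 : E, y)).
  exact: (is_diff_pair (is_diff_cst _ _) (is_diff_id _)).
have [] := @near_eq_is_diff _ _ _ _ (conj_chart (chart_inv c x)) _ e _
  (is_diff_comp dp d2).
  have pc : {for e, continuous (fun y : E => (x, y))}.
    by apply: continuous_pair_at; [exact: cst_continuous|by move=> ?].
  have hn : nbhs e [set y | conj_dom (x, y)].
    exact: (pc _ (open_nbhs_nbhs (conj open_conj_dom hx))).
  apply: filterS hn => y hy; exact: conj2E.
by move=> _ dE; exact: (congr1 (fun f : E -> E => f v) dE).
Qed.

Lemma Ck_Ad_in_chart k v :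
  Ck_on k Ad_dom (fun x => Ad_in_chart c (chart_inv c x) v).
Proof.
apply: (@Ck_ext _ _ _ _ _ (fun x => 'D_(0, v) conj2 (x, e))).
- exact: open_Ad_dom.
- by move=> x hx; rewrite Ad_domE.
apply: (@Ck_comp _ _ _ _ _ _ conj_dom (fun x => (x, e)) ('D_(0, v) conj2)).
- by apply: frame_prod; exact: frame_row.
- exact: open_Ad_dom.
- exact: open_conj_dom.
- by [].
- apply: (Ck_pair open_Ad_dom); first exact: (Ck_id _ open_Ad_dom).
  exact: Ck_cst.
- by have [_] := Ck_conj2 k.+1; apply.
Qed.

End Conjugation.
End LieGroup.

(** * The coadjoint action along paths in the group *)

Lemma connected_locally_constant (T : topologicalType) (W : set T) (x0 : T) :
  connected [set: T] -> (forall x, \forall y \near x, W x <-> W y) -> W x0 ->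
  forall x, W x.
Proof.
move=> Tconn locW Wx0 x.
have oW : open W.
  by rewrite openE => y Wy; apply: filterS (locW y) => z [+ _]; apply.
have oWC : open (~` W).
  by rewrite openE => y Wy; apply: filterS (locW y) => z yz /yz.
have -> // : W = [set: T].
apply: Tconn; [by exists x0|by exists W => //; rewrite setTI|].
by exists W; rewrite ?setTI// -[W]setCK; exact: open_closedC.
Qed.

Section Pairing.
Variables (R : realType) (n : nat).
Local Notation E := 'rV[R]_n.+1.

Lemma pairing_linear (F : E) : linear (pairing F).
Proof.
move=> a u v; rewrite /pairing /= scaler_sumr -big_split /=.
by apply: eq_bigr => i _; rewrite !mxE mulrDr mulrCA.
Qed.

Definition pairingL (F : E) : {linear E -> R} :=
  HB.pack (pairing F) (GRing.isLinear.Build _ _ _ _ _ (pairing_linear F)).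

Lemma pairing_continuous (F : E) : continuous (pairingL F).
Proof.
have : Ck_on (W := R) 0 [set: E] (fun x => \sum_i F 0 i * x 0 i).
  apply: (Ck_sum _ openT) => i; apply: (CkM openT); first exact: Ck_cst.
  by apply: (Ck_coord _ openT); exact: (Ck_id _ openT).
by move=> h x; exact: h.
Qed.

Lemma pairing_delta (F : E) i : pairing F (delta_mx 0 i) = F 0 i.
Proof.
rewrite /pairing (bigD1 i)//= mxE !eqxx mulr1 big1 ?addr0// => j ji.
by rewrite mxE eqxx (negbTE ji) mulr0.
Qed.

Lemma pairing_ext (F F' : E) : pairing F =1 pairing F' -> F = F'.
Proof. by move=> FF'; apply/rowP => i; rewrite -!pairing_delta FF'. Qed.

Lemma pairing_rowl (l : {linear E -> R}) (A : E) :
  pairing (\row_i l (delta_mx 0 i)) A = l A.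
Proof.
rewrite [in RHS](row_sum_delta A) linear_sum; apply: eq_bigr => i _.
by rewrite mxE linearZ mulrC.
Qed.

End Pairing.

Section Coadjoint.
Variables (R : realType) (n : nat) (G : lieGroupType R n).
Local Notation E := 'rV[R]_n.+1.
Variables (br : E -> E -> E) (iota : lie_algebra_iso G br).
Let c := iso_chart iota.
Let B := iso_mx iota.
Let cA : lie_atlas c. Proof. exact: iso_chart_atlas. Qed.
Let c1 : chart_dom c 1%g. Proof. exact: iso_chart_dom1. Qed.
Let e := c 1%g.
Let Bunit : B \in unitmx. Proof. exact: iso_mx_unit. Qed.

(** F \o ad A, the value at F of the vector field xi_A. *)
Definition adstar (A F : E) : E := \row_i pairing F (br A (delta_mx 0 i)).

Lemma Ad_linear g : linear (Ad iota g).
Proof.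
move=> a u v; rewrite /Ad mulmxDl -scalemxAl Ad_in_chart_linear//.
by rewrite mulmxDl scalemxAl.
Qed.

Lemma AdM g h A : Ad iota (g * h)%g A = Ad iota g (Ad iota h A).
Proof. by rewrite /Ad Ad_in_chartM// mulmxKV. Qed.

Lemma Ad1 A : Ad iota 1%g A = A.
Proof. by rewrite /Ad Ad_in_chart1// mulmxK. Qed.

Lemma pairing_coadjoint g F A :
  pairing (coadjoint iota g F) A = pairing F (Ad iota g^-1%g A).
Proof.
pose m := GRing.isLinear.Build _ _ _ _ _ (Ad_linear g^-1%g).
pose L : {linear E -> E} := HB.pack (Ad iota g^-1%g) m.
exact: (pairing_rowl (pairingL F \o L)).
Qed.

Lemma coadjointM g h F :
  coadjoint iota (g * h)%g F = coadjoint iota g (coadjoint iota h F).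
Proof.
apply: pairing_ext => A.
apply: (etrans (pairing_coadjoint (g * h)%g F A)).
apply: esym; apply: (etrans (pairing_coadjoint g _ A)).
apply: (etrans (pairing_coadjoint h F _)); congr (pairing F _).
by rewrite invgM; exact/esym/AdM.
Qed.

Lemma coadjoint1 F : coadjoint iota 1%g F = F.
Proof. by apply: pairing_ext => A; rewrite pairing_coadjoint invg1 Ad1. Qed.

Lemma coadjointK g F : coadjoint iota g^-1%g (coadjoint iota g F) = F.
Proof. by rewrite -coadjointM mulVg coadjoint1. Qed.

(** Inverting the group element makes Ad, and not its inverse, appear in the
    coordinates, so that the derivative at 1 is F \o ad A with the right sign. *)
Definition orbit_chart (F x : E) : E := coadjoint iota (chart_inv c x)^-1%g F.

Lemma orbit_chartE F x i :
  orbit_chart F x 0 i = pairing F (Ad iota (chart_inv c x) (delta_mx 0 i)).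
Proof. by rewrite -pairing_delta pairing_coadjoint invgK. Qed.

Lemma mulmx_continuous p (M : 'M[R]_(n.+1, p.+1)) :
  continuous (mulmxr M : {linear E -> 'rV[R]_p.+1}).
Proof.
have : Ck_on 0 [set: E] (fun x : E => x *m M).
  apply: (Ck_row openT) => j.
  apply: (@Ck_ext _ E R 0 _ (fun x => \sum_i x 0 i * M i j) _ openT).
    by move=> x _; rewrite mxE.
  apply: (Ck_sum _ openT) => i; apply: (CkM openT); last exact: Ck_cst.
  by apply: (Ck_coord _ openT); exact: (Ck_id _ openT).
by move=> h x; exact: h.
Qed.

Lemma Ck_orbit_chart k F : Ck_on k (Ad_dom c) (orbit_chart F).
Proof.
have oA : open (Ad_dom c) by exact: open_Ad_dom.
apply: (Ck_row oA) => i.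
apply: (@Ck_ext _ E R _ _ (fun x => pairingL F (mulmxr (invmx B)
    (Ad_in_chart c (chart_inv c x) (delta_mx 0 i *m B)))) _ oA) => [x _|].
  by rewrite orbit_chartE.
apply: (@Ck_linear_comp _ _ _ _ _ _ (pairingL F) _ oA).
  exact: pairing_continuous.
apply: (@Ck_linear_comp _ _ _ _ _ _ (mulmxr (invmx B)) _ oA).
  exact: mulmx_continuous.
exact: Ck_Ad_in_chart.
Qed.

Lemma is_diff_orbit_chart F :
  is_diff e (orbit_chart F) (fun v => adstar (v *m invmx B) F).
Proof.
have oA : open (Ad_dom c) by exact: open_Ad_dom.
have Ae : Ad_dom c e by exact: Ad_dom_unit.
have := Ck_diff (Ck_orbit_chart 1 F) Ae; congr is_diff_def.
apply/funext => v; apply/rowP => i.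
have [dk _] := Ck_orbit_chart 1 F.
rewrite derive_mx ?mxE; last exact/diff_derivable/dk.
rewrite -[br _ _](mulmxK Bunit) -(iso_bracket iota) mulmxKV//.
have [dA _] := Ck_Ad_in_chart cA 1 (delta_mx 0 i *m B).
have dl := is_diff_comp (differentiableP (dA e Ae))
  (is_diff_linear _ (@mulmx_continuous _ (invmx B))).
have dp := is_diff_comp dl (is_diff_linear _ (@pairing_continuous _ _ F)).
rewrite /bracket_in_chart (deriveE v (dA e Ae)).
apply: etrans (is_diffE v dp); congr derive.
by apply/funext => x; rewrite orbit_chartE.
Qed.

Lemma orbit_chart_unit F : orbit_chart F e = F.
Proof. by rewrite /orbit_chart chart_funK// invg1 coadjoint1. Qed.

Lemma adstarN A F : adstar (- A) F = - adstar A F.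
Proof.
have adE C : adstar C F = 'd (orbit_chart F) e (C *m B).
  by rewrite (@diff_val _ _ _ _ _ _ _ (is_diff_orbit_chart F)) mulmxK.
by rewrite !adE mulNmx linearN.
Qed.

(** As a(-t)^-1 = a(t), the curve K(a(-t)) F is orbit_chart F along a. *)
Lemma fundamental_vectorE A F v : fundamental_vector iota A F v -> v = adstar A F.
Proof.
move=> [a [aM ac _ a'] aF].
have a0 : a 0 = 1%g by apply: (@mulgI _ (a 0)); rewrite -aM addr0 mulg1.
have aV t : (a (- t))^-1%g = a t.
  by apply: (@mulgI _ (a (- t))); rewrite mulgV -aM addNr a0.
have ca0 : (iso_chart iota \o a) 0 = e by rewrite /= a0.
have dk : is_diff ((iso_chart iota \o a) 0) (orbit_chart F)
    (fun v => adstar (v *m invmx B) F).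
  by rewrite ca0; exact: is_diff_orbit_chart.
have := is_derive_along a' dk; rewrite mulmxK// => h.
have near0 : \forall t \near (0 : R),
    (orbit_chart F \o (iso_chart iota \o a)) t = coadjoint iota (a (- t)) F.
  have : nbhs (0 : R) (a @^-1` chart_dom c).
    apply: (ac 0); apply: open_nbhs_nbhs; split; first exact: chart_dom_open.
    by rewrite a0.
  apply: filterS => t ht /=.
  have aN : (a t)^-1%g = a (- t) by rewrite -(aV t) invgK.
  apply: (etrans (congr1 (fun g => coadjoint iota g^-1%g F) (chart_funK ht))).
  exact: (congr1 (fun g => coadjoint iota g F) aN).
have [_ <-] := near_eq_is_derive near0 h.
by have [_ <-] := aF.
Qed.

Definition coadjoint_curve (k A : R -> E) :=
  (forall s, is_derive s (1 : R) k (adstar (A s) (k s))) /\ continuous A.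

Lemma coadjoint_curve_rev k A t : coadjoint_curve k A ->
  coadjoint_curve (fun s => k (t - s)) (fun s => - A (t - s)).
Proof.
move=> [kD Ac]; split=> s.
  rewrite adstarN.
  have ts : is_derive s (1 : R) (fun s : R => t - s) (-1).
    by rewrite -[-1]add0r; exact: is_deriveB.
  have := is_derive_along ts (is_derive_diff (kD (t - s))).
  by rewrite scaleN1r.
apply: continuousN; apply: (@continuous_comp _ _ _ (fun s => t - s) A).
  by apply: continuousB; [exact: cst_continuous|move=> ?].
exact: Ac.
Qed.

(** The segment from 1 to x is run through as e + sin s *: (x - e): this is defined
    for all times and stays in any ball around e that contains x.  To
    differentiate at time s, the path is translated back to 1. *)
Lemma coadjoint_curve_chart (F x : E) :
  (forall s, inv_dom c (e + sin s *: (x - e))) ->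
  exists k A, [/\ coadjoint_curve k A, k 0 = F & k (pi / 2) = orbit_chart F x].
Proof.
move=> xdom; set d := x - e; pose g (s : R) : E := e + sin s *: d.
have gC k : Ck_on k [set: R] g.
  apply: (CkD openT); first exact: Ck_cst.
  apply: (Ck_scale openT); last exact: Ck_cst.
  by apply: (Ck_trigo openT _).2; exact: (Ck_id _ openT).
have g' s : is_derive s (1 : R) g (cos s *: d).
  have sd : is_diff s sin (fun v => v *: cos s).
    exact: (is_derive_diff (is_derive_sin s)).
  have := is_diff_derive (1 : R)
    (is_diffD (is_diff_cst e s) (is_diff_scale sd (is_diff_cst d s))).
  by rewrite !fctE /= scaler0 !add0r; rewrite /(_ *: cos s) /= mul1r.
pose m := mul_chart c c c.
have mdom y : inv_dom c y -> mul_dom c c c (inv_chart c y, y).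
  move=> [hy hyV]; split=> //=; first by exists (chart_inv c y)^-1%g.
  by rewrite /inv_chart chart_funK// mulVg.
pose A s := (cos s *: 'D_(0, d) m (inv_chart c (g s), g s)) *m invmx B.
exists (orbit_chart F \o g), A; split; last 2 first.
- by rewrite /= /g sin0 scale0r addr0 orbit_chart_unit.
- by rewrite /= /g sin_pihalf scale1r /d addrC subrK.
split=> s; last first.
  pose p t := (inv_chart c (g t), g t).
  have pc : {for s, continuous p}.
    apply: continuous_pair_at; last by apply: (Ck_continuous (gC 0%N)).
    apply: (@continuous_comp _ _ _ g (inv_chart c)).
      by apply: (Ck_continuous (gC 0%N)).
    exact: (Ck_continuous (lie_inv_smooth c c cA cA 0%N) (xdom s)).
  have Dc : {for p s, continuous ('D_(0, d) m)}.
    have [_ Dm] : Ck_on 1 (mul_dom c c c) m by exact: lie_mul_smooth.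
    exact: (Dm (0, d) _ (mdom _ (xdom s))).
  have fc : {for s, continuous (fun t => cos t *: 'D_(0, d) m (p t))}.
    apply: cvgZ; first exact: continuous_cos.
    exact: (continuous_comp pc Dc).
  exact: (continuous_comp fc (@mulmx_continuous _ (invmx B) _)).
have gs := xdom s; rewrite -/d -/(g s) in gs.
have [gsI gsV] := gs.
(* left translation by the inverse of the element reached at time s *)
pose y (z : E) := m (inv_chart c (g s), z).
have ys : y (g s) = e.
  by rewrite /y /m /mul_chart /inv_chart /= chart_funK// mulVg.
have mdm : is_diff (inv_chart c (g s), g s) m
    (fun v => 'D_v m (inv_chart c (g s), g s)).
  exact: (Ck_diff (lie_mul_smooth c c c cA cA cA 1%N) (mdom _ gs)).
have yd : is_diff (g s) y (fun v => 'D_(0, v) m (inv_chart c (g s), g s)).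
  have pd : is_diff (g s) (fun z => (inv_chart c (g s), z))
      (fun v : E => (0 : E, v)).
    exact: (is_diff_pair (is_diff_cst _ _) (is_diff_id _)).
  exact: (is_diff_comp pd mdm).
have kd : is_diff (y (g s)) (orbit_chart (orbit_chart F (g s)))
    (fun v => adstar (v *m invmx B) (orbit_chart F (g s))).
  by rewrite ys; exact: is_diff_orbit_chart.
have kE : \forall z \near g s,
    (orbit_chart (orbit_chart F (g s)) \o y) z = orbit_chart F z.
  have pc : {for g s, continuous (fun z : E => (inv_chart c (g s), z))}.
    by apply: continuous_pair_at; [exact: cst_continuous|move=> ?].
  have hn : nbhs (g s) [set z | mul_dom c c c (inv_chart c (g s), z)].
    exact: (pc _ (open_nbhs_nbhs (conj (@open_mul_dom _ _ _ c c c) (mdom _ gs)))).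
  have iE : chart_inv c (inv_chart c (g s)) = (chart_inv c (g s))^-1%g.
    exact: (chart_funK gsV).
  apply: filterS hn => z [_ _ /chart_funK yE].
  have {iE}yE : chart_inv c (y z) = ((chart_inv c (g s))^-1 * chart_inv c z)%g.
    by rewrite -iE; exact: yE.
  have gE : ((chart_inv c (y z))^-1 * (chart_inv c (g s))^-1 =
    (chart_inv c z)^-1)%g by rewrite yE invgM invgK mulgK.
  apply: (etrans (esym (coadjointM (chart_inv c (y z))^-1 _ F))).
  exact: (congr1 (fun g => coadjoint iota g F) gE).
have kd' := near_eq_is_diff kE (is_diff_comp yd kd).
have := is_derive_along (g' s) kd'.
congr is_derive => /=; rewrite /A; congr (adstar (_ *m _) _).
have [dm _] := mdm.
by rewrite !deriveE// -linearZ /=; congr ('d m _ (_, _)); rewrite scaler0.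
Qed.

Lemma coadjoint_curve_local : exists2 N : set G, nbhs 1%g N &
  forall h F, N h -> exists k A,
    [/\ coadjoint_curve k A, k 0 = F & k (pi / 2) = coadjoint iota h^-1%g F].
Proof.
have ie : inv_dom c e.
  split; first exact: chart_unit_img.
  by rewrite chart_funK// invg1.
have [r /= r0 rI] : exists2 r, 0 < r & ball e r `<=` inv_dom c.
  exact/nbhs_ballP/(open_nbhs_nbhs (conj (@open_inv_dom _ _ _ c) ie)).
exists [set h | chart_dom c h /\ ball e r (c h)].
  apply: filterI; first exact: (open_nbhs_nbhs (conj (@chart_dom_open _ _ _ c) c1)).
  by apply: (chart_fun_continuous c1); exact: nbhsx_ballx.
move=> h F [ch hr].
have [|k [A [kA k0 k1]]] := @coadjoint_curve_chart F (c h).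
  move=> s; apply: rI; move: hr; rewrite -!ball_normE /= => hr.
  rewrite opprD addNKr normrN normrZ; apply: le_lt_trans hr.
  rewrite [leRHS]distrC ler_piMl//.
  by rewrite ler_norml sin_geN1 sin_le1.
exists k, A; split; [exact: kA|exact: k0|apply: (etrans k1)].
exact: (congr1 (fun g => coadjoint iota g^-1%g F) (chart_funK ch)).
Qed.

(** That K(g) F belongs to S is a locally constant property of g: neighbours are
    joined by a coadjoint curve, which can be run through in both directions. *)
Lemma coadjoint_orbit_sub (S : set E) (F : E) : connected [set: G] ->
  (forall k A, coadjoint_curve k A -> S (k 0) -> S (k (pi / 2))) -> S F ->
  coadjoint_orbit iota F `<=` S.
Proof.
move=> Gconn curveS SF _ [g _ <-].
have [N N1 Ncurve] := coadjoint_curve_local.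
apply: (@connected_locally_constant G (fun g => S (coadjoint iota g F)) 1%g) => //;
  last by rewrite coadjoint1.
move=> {}g.
have gc : {for g, continuous (fun y : G => g * y^-1)%g}.
  apply: (@continuous_comp _ _ _ (fun y : G => (g, y^-1%g))
    (fun g : G * G => (g.1 * g.2)%g)); last exact: lie_mul_continuous.
  apply: continuous_pair_at; first exact: cst_continuous.
  exact: lie_inv_continuous.
have Ng : nbhs g [set y | N (g * y^-1)%g] by apply: gc; rewrite mulgV.
apply: filterS Ng => y Ny.
have [k [A [kA k0 k1]]] := Ncurve _ (coadjoint iota g F) Ny.
have {}k1 : k (pi / 2) = coadjoint iota y F.
  apply: (etrans k1); apply: (etrans (esym (coadjointM _ g F))).
  have yE : ((g * y^-1)^-1 * g)%g = y by rewrite invgM invgK mulgVK.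
  exact: (congr1 (fun g => coadjoint iota g F) yE).
split; first by rewrite -k0 -k1; exact: curveS kA.
have := curveS _ _ (coadjoint_curve_rev (pi / 2) kA).
by rewrite subr0 subrr k0 k1.
Qed.

End Coadjoint.

(** * Linear differential equations *)

(** The bound -1 leaves room for a two-sided derivative at 0. *)
Lemma continuous_antiderivative (R : realType) (a : R -> R) : continuous a ->
  exists2 b : R -> R, b 0 = 0 &
    forall s : R, -1 < s -> is_derive s (1 : R) b (a s).
Proof.
move=> ac; pose F x := (\int[lebesgue_measure]_(t in `[-1, x]) a t)%R.
exists (fun x => F x - F 0); first by rewrite subrr.
move=> s s1; have su : s < s + 1 by rewrite ltrDl.
have ai : lebesgue_measure.-integrable `[(-1 : R), s + 1] (EFin \o a).
  apply: continuous_compact_integrable; first exact: segment_compact.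
  exact: continuous_subspaceT.
have [Fd Fa] := continuous_FTC1_closed su ai s1 (ac s).
have Fs : is_derive s (1 : R) F (a s).
  by split; [exact: Fd|rewrite -derive1E; exact: Fa].
by rewrite -[a s]subr0; apply: is_deriveB.
Qed.

(** The function f s * e^(- C s) is nonincreasing on [0, t]. *)
Lemma gronwall (R : realType) (f f' : R -> R) (C t : R) : 0 <= t ->
  (forall s : R, -1 < s -> is_derive s (1 : R) f (f' s)) ->
  (forall s : R, 0 <= s <= t -> f' s <= C * f s) -> f 0 = 0 -> f t <= 0.
Proof.
move=> t0 fD f'C f0.
pose g s := f s * expR (- C * s).
have gD (s : R) : -1 < s ->
    is_derive s (1 : R) g ((f' s - C * f s) * expR (- C * s)).
  move=> s1; have fs := fD s s1.
  have lin : is_derive s (1 : R) (fun s : R => - C * s) (- C).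
    have := is_deriveZ (- C) (is_derive_id s (1 : R)).
    by rewrite /GRing.scale /= mulr1.
  have es := is_derive1_comp (is_derive_expR (- C * s)) lin.
  have := is_deriveM fs es; congr is_derive.
  by rewrite /GRing.scale /=; ring.
have g0 : g 0 = 0 by rewrite /g f0 mul0r.
have gt : g t <= g 0.
  apply: (@ler0_derive1_nincr _ g 0 t) => // [s|s|].
  - by rewrite in_itv /= => /andP[s0 _]; have [] := gD s ltac:(lra).
  - rewrite in_itv /= => /andP[s0 st].
    have [_] := gD s ltac:(lra); rewrite derive1E => ->.
    by rewrite mulr_le0_ge0 ?expR_ge0// subr_le0 f'C//; lra.
  apply: derivable_within_continuous => s; rewrite in_itv /= => /andP[s0 st].
  by have [] := gD s ltac:(lra).
by move: gt; rewrite g0 /g pmulr_lle0 ?expR_gt0.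
Qed.

Lemma is_derive_row (R : realType) n (w : R -> 'rV[R]_n) (s : R) (d : 'rV[R]_n) :
  is_derive s (1 : R) w d <->
  forall i, is_derive s (1 : R) (fun t => w t 0 i) (d 0 i).
Proof.
split=> [[wd <-] i|wD].
  split; last by rewrite derive_mx// mxE.
  by have /derivable_mxP := wd; apply.
have wd : derivable w s 1.
  by apply/derivable_mxP => i j; rewrite ord1; have [] := wD j.
split=> //; rewrite derive_mx//; apply/rowP => j; rewrite mxE.
by have [_ ->] := wD j.
Qed.

(** The squared norm q satisfies q' <= 2 M q, where M s is the sum of the absolute
    values of the entries of N s. *)
Lemma linear_ode_unique (R : realType) n (w : R -> 'rV[R]_n)
    (N : R -> 'M[R]_n) :
  (forall i j, continuous (fun s => N s i j)) ->
  (forall s : R, -1 < s -> is_derive s (1 : R) w (w s *m N s)) ->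
  w 0 = 0 -> forall t, 0 <= t -> w t = 0.
Proof.
move=> Nc wD w0 t t0.
pose q s := \sum_i (w s 0 i * w s 0 i).
pose q' s := \sum_i (2 * w s 0 i * (w s *m N s) 0 i).
pose M s := \sum_i \sum_j `|N s i j|.
have Mc : continuous M.
  have M0 : Ck_on (V := R) (W := R) 0 [set: R] M.
    apply: (Ck_sum _ openT) => i; apply: (Ck_sum _ openT) => j s _.
    by apply: cvg_norm; exact: Nc.
  by move=> s; exact: M0.
have [c _ Mmax] := EVT_max t0 (continuous_subspaceT Mc).
have qD (s : R) : -1 < s -> is_derive s (1 : R) q (q' s).
  move=> s1; have /is_derive_row ws := wD s s1.
  have -> : q = \sum_i (fun s => w s 0 i * w s 0 i).
    by apply/funext => u; rewrite fct_sumE.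
  apply: is_derive_sum => i; have := is_deriveM (ws i) (ws i).
  by congr is_derive; rewrite /GRing.scale /=; ring.
have qge0 s i : w s 0 i * w s 0 i <= q s.
  rewrite /q (bigD1 i)//= lerDl; apply: sumr_ge0 => j _.
  by rewrite -expr2 sqr_ge0.
have q'q s : q' s <= 2 * M s * q s.
  rewrite -mulrA /q' /M mulr_suml mulr_sumr.
  under eq_bigr do rewrite mxE mulr_sumr.
  rewrite exchange_big /=; apply: ler_sum => i _.
  rewrite mulr_suml mulr_sumr; apply: ler_sum => j _.
  apply: le_trans (ler_norm _) _; rewrite !normrM ger0_norm// -!mulrA ler_pM2l//.
  rewrite mulrA mulrC ler_wpM2l//.
  have nE (x : R) : `|x| * `|x| = x * x.
    by rewrite -normrM ger0_norm// -expr2 sqr_ge0.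
  have := qge0 s i; have := qge0 s j; rewrite -(nE (w s 0 i)) -(nE (w s 0 j)).
  by have := sqr_ge0 (`|w s 0 i| - `|w s 0 j|); nra.
have qt : q t <= 0.
  apply: (gronwall (C := 2 * M c) t0 qD); last first.
    by rewrite /q w0 big1// => i _; rewrite mxE mul0r.
  move=> s st; apply: (le_trans (q'q s)); rewrite ler_wpM2r//.
    by apply: sumr_ge0 => i _; rewrite -expr2; exact: sqr_ge0.
  by rewrite ler_pM2l// Mmax.
apply/rowP => i; rewrite mxE; apply/eqP.
rewrite -sqrf_eq0 expr2; apply/eqP/le_anti.
by rewrite (le_trans (qge0 t i) qt) -expr2 sqr_ge0.
Qed.

(** * Local surjectivity *)

Section RowNorm.
Variables (R : realType) (n : nat).

Lemma row_norm_coord (x : 'rV[R]_n.+1) i : `|x 0 i| <= `|x|.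
Proof.
by rewrite [leRHS]/Num.Def.normr /= mx_normrE; exact: (le_bigmax _ _ (0, i)).
Qed.

Lemma row_norm_le (x : 'rV[R]_n.+1) c : 0 <= c -> (forall i, `|x 0 i| <= c) ->
  `|x| <= c.
Proof.
move=> c0 xc; rewrite [leLHS]/Num.Def.normr /= mx_normrE; apply: bigmax_le => //.
by move=> -[i j] _ /=; rewrite ord1.
Qed.

Lemma row_sum_norm_le (l : {linear 'rV[R]_n.+1 -> 'rV[R]_n.+1}) c v : 0 <= c ->
  (forall j, `|l (delta_mx 0 j)| <= c) -> `|l v| <= n.+1%:R * c * `|v|.
Proof.
move=> c0 lc; rewrite [v in leLHS](row_sum_delta v) linear_sum.
apply: le_trans (ler_norm_sum _ _ _) _.
rewrite -mulrA -[X in X%:R]card_ord mulr_natl -sumr_const.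
apply: ler_sum => j _; rewrite linearZ normrZ mulrC.
by apply: ler_pM => //; exact: row_norm_coord.
Qed.

Lemma mean_value_le (h : 'rV[R]_n.+1 -> 'rV[R]_n.+1)
    (h' : 'rV[R]_n.+1 -> {linear 'rV[R]_n.+1 -> 'rV[R]_n.+1}) x y c : 0 <= c ->
  (forall t : R, 0 <= t <= 1 ->
     is_diff (x + t *: (y - x)) h (h' (x + t *: (y - x))) /\
     `|h' (x + t *: (y - x)) (y - x)| <= c) ->
  `|h y - h x| <= c.
Proof.
move=> c0 hD; apply: row_norm_le => // i; set v := y - x in hD.
pose g (t : R) := x + t *: v.
have g' (t : R) : is_derive t (1 : R) g v.
  have := is_diff_derive (1 : R)
    (is_diffD (is_diff_cst x t) (is_diff_scale (is_diff_id t) (is_diff_cst v t))).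
  by rewrite !fctE /= scaler0 !add0r scale1r.
pose f (t : R) : R := h (g t) 0 i.
have f' (t : R) : 0 <= t <= 1 -> is_derive t (1 : R) f (h' (g t) v 0 i).
  move=> t01; have [ht _] := hD t t01.
  by have /is_derive_row := is_derive_along (g' t) ht; apply.
have [||z z01] := @MVT R f (fun t => h' (g t) v 0 i) 0 1 ltr01.
- by move=> t; rewrite in_itv /= => /andP[t0 t1]; apply: f'; rewrite !ltW.
- apply: derivable_within_continuous => t; rewrite in_itv /= => t01.
  by have [] := f' t t01.
rewrite subr0 mulr1 /f /g scale1r scale0r addr0 /v subrKC.
rewrite !mxE => ->; move: z01; rewrite in_itv /= => /andP[z0 z1].
have [_ hz] := hD z ltac:(by rewrite !ltW).
exact: le_trans (row_norm_coord _ _) hz.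
Qed.

End RowNorm.

HB.instance Definition _ (R : realType) m n := Complete.on 'M[R]_(m.+1, n.+1).

Section LocalSurjectivity.
Variables (R : realType).

(** A point x is sent to y if and only if it is fixed by x |-> y + (x - f x); the
    derivative of x - f x vanishes at x0, so that this map is a contraction of a
    small closed ball around x0. *)
Lemma local_surjectivity_id n (f : 'rV[R]_n.+1 -> 'rV[R]_n.+1) (U : set 'rV[R]_n.+1) x0 :
  open U -> U x0 -> Ck_on 1 U f -> (forall v, 'D_v f x0 = v) ->
  nbhs (f x0) (f @` U).
Proof.
move=> oU Ux0 [fD Dfc] f'id.
pose eps : R := (2 * n.+1%:R)^-1.
have eps0 : 0 < eps by rewrite invr_gt0 mulr_gt0// ltr0n.
have near_j : \forall x \near x0,
    forall j, `|delta_mx 0 j - 'D_(delta_mx 0 j) f x| <= eps.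
  apply: (@filter_forall _ 'I_n.+1
    (fun j x => `|delta_mx 0 j - 'D_(delta_mx 0 j) f x| <= eps) (nbhs x0)
    (nbhs_filter x0)) => j.
  have /cvgrPdist_le/(_ _ eps0) := Dfc (delta_mx 0 j) x0 Ux0.
  by rewrite f'id.
have [r0 /= r00 hr0] : exists2 r : R, 0 < r & ball x0 r `<=`
    U `&` [set x | forall j, `|delta_mx 0 j - 'D_(delta_mx 0 j) f x| <= eps].
  apply/nbhs_ballP; apply: filterI near_j.
  exact: (open_nbhs_nbhs (conj oU Ux0)).
pose r := r0 / 2; have r_gt0 : 0 < r by rewrite divr_gt0.
pose K := closed_ball_ (fun x : 'rV[R]_n.+1 => `|x|) x0 r.
have Kr0 x : K x -> ball x0 r0 x.
  rewrite -ball_normE /= => Kx; apply: le_lt_trans Kx _.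
  by rewrite /r ltr_pdivrMr// ltr_pMr// ltr1n.
have KU x : K x -> U x by move=> /Kr0/hr0[].
pose h x := x - f x.
have hlip x y : K x -> K y -> `|h y - h x| <= 2^-1 * `|y - x|.
  move=> Kx Ky.
  have lin z : linear (fun v => v - 'd f z v).
    by move=> a u v; rewrite linearP scalerBr opprD addrACA.
  pose h' z : {linear 'rV[R]_n.+1 -> 'rV[R]_n.+1} :=
    HB.pack (fun v => v - 'd f z v) (GRing.isLinear.Build _ _ _ _ _ (lin z)).
  apply: (mean_value_le (h' := h')) => [|t /andP[t0 t1]].
    by rewrite mulr_ge0// invr_ge0.
  set z := x + _; have Kz : K z.
    rewrite /K /closed_ball_ /=.
    have -> : x0 - z = (1 - t) *: (x0 - x) + t *: (x0 - y).
      rewrite /z; apply/rowP => i; rewrite !mxE; ring.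
    apply: le_trans (ler_normD _ _) _; rewrite !normrZ.
    rewrite (ger0_norm t0) ger0_norm ?subr_ge0//.
    have : (1 - t) * `|x0 - x| <= (1 - t) * r by rewrite ler_wpM2l// subr_ge0.
    have : t * `|x0 - y| <= t * r by rewrite ler_wpM2l.
    by lra.
  split.
    exact: (is_diffB (is_diff_id z) (differentiableP (fD z (KU z Kz)))).
  have := @row_sum_norm_le _ _ (h' z) eps (y - x) (ltW eps0).
  have -> : n.+1%:R * eps = 2^-1 :> R.
    by rewrite /eps invfM mulrCA mulfV ?mulr1// pnatr_eq0.
  apply=> j; have [_ /(_ j)] := hr0 z (Kr0 z Kz).
  by rewrite deriveE//; exact: fD (KU z Kz).
apply/nbhs_ballP; exists (r / 2) => /=; first by rewrite divr_gt0.
move=> y; rewrite -ball_normE /= => yr.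
have Kx0 : K x0 by rewrite /K /closed_ball_ /= subrr normr0 ltW.
have [T TE] : {T : {fun K >-> K} | (fun x => y + h x) = T}.
  apply: Pfun => x Kx; rewrite /K /closed_ball_ /=.
  have -> : x0 - (y + h x) = (f x0 - y) + (h x0 - h x).
    by rewrite /h; apply/rowP => i; rewrite !mxE; ring.
  apply: le_trans (ler_normD _ _) _.
  have := hlip x x0 Kx Kx0; move: Kx yr; rewrite /K /closed_ball_ /=; lra.
have [|||p Kp pE] := @banach_fixed_point _ _ K T.
- exists (2^-1)%:nng; split=> /=; first by rewrite invf_lt1// ltr1n.
  move=> [a b] [/= Ka Kb]; rewrite -TE /=.
  by rewrite opprD addrACA subrr add0r; exact: hlip.
- exact: closed_closed_ball_.
- by exists x0.
exists p; first exact: KU.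
by move: pE; rewrite -TE /= /h addrCA -{1}[p]addr0 => /addrI/esym/subr0_eq ->.
Qed.

(** The plane as a space of row vectors, where [local_surjectivity_id] applies. *)
Definition row2 (p : R * R) : 'rV[R]_2 := \row_i (if i == 0 then p.1 else p.2).

Lemma row2_linear : linear row2.
Proof. by move=> a u v; apply/rowP => i; rewrite !mxE; case: ifP. Qed.

(** dp /\ dq *)
Definition wedge (u v : R * R) : R := u.1 * v.2 - v.1 * u.2.

Lemma row2_inj : injective row2.
Proof.
move=> [a b] [c d] /rowP pq; congr pair.
  by have := pq 0; rewrite !mxE.
by have := pq 1; rewrite !mxE.
Qed.

(** Cramer's rule *)
Lemma row2_inverse (u1 u2 : R * R) (v : 'rV[R]_2) : wedge u1 u2 != 0 ->
  row2 (v 0 0 *: ((wedge u1 u2)^-1 *: (u2.2 *: u1 - u1.2 *: u2)) +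
        v 0 1 *: ((wedge u1 u2)^-1 *: (u1.1 *: u2 - u2.1 *: u1))) = v.
Proof.
move: u1 u2 => [a b] [c d]; rewrite /wedge /= => w0; apply/rowP => i.
rewrite mxE; have [->|->] : i = 0 \/ i = 1.
- by case: i => [[|[|//]] ip]; [left|right]; exact: val_inj.
- by rewrite /= /GRing.scale /=; field.
- by rewrite /= /GRing.scale /=; field.
Qed.

Lemma linear_comb2 (V W : lmodType R) (l : {linear V -> W}) (s t c a b a' b' : R)
    (x y : V) :
  l (s *: (c *: (a *: x - b *: y)) + t *: (c *: (a' *: y - b' *: x))) =
  s *: (c *: (a *: l x - b *: l y)) + t *: (c *: (a' *: l y - b' *: l x)).
Proof.
have lZ e u : l (e *: u) = e *: l u by exact: linearZ_LR.
by rewrite linearD !lZ !linearB !lZ.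
Qed.

(** On the plane through x0 spanned by v1 and v2 the derivative of f is invertible;
    a1 and a2 are the vectors that it sends to the standard basis. *)
Lemma local_surjectivity (V : normedModType R) (f : V -> R * R) (U : set V) x0 v1 v2 :
  finite_frame V -> open U -> U x0 -> Ck_on 1 U f ->
  wedge ('D_v1 f x0) ('D_v2 f x0) != 0 ->
  nbhs (f x0) (f @` U).
Proof.
move=> frV oU Ux0 Cf; set u1 := 'D_v1 f x0; set u2 := 'D_v2 f x0 => w0.
set w := wedge u1 u2 in w0.
pose L2 : {linear (R * R)%type -> 'rV[R]_2} :=
  HB.pack row2 (GRing.isLinear.Build _ _ _ _ _ row2_linear).
have L2c : continuous L2.
  have : Ck_on 0 [set: R * R] row2.
    apply: (Ck_row openT) => i.
    apply: (@Ck_ext _ _ R _ _ (fun p => if i == 0 then p.1 else p.2) _ openT).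
      by move=> p _; rewrite mxE.
    by case: (i == 0); [exact: (Ck_fst _ openT)|exact: (Ck_snd _ openT)].
  by move=> c x; exact: (c x I).
pose a1 := w^-1 *: (u2.2 *: v1 - u1.2 *: v2).
pose a2 := w^-1 *: (u1.1 *: v2 - u2.1 *: v1).
pose g (z : 'rV[R]_2) := x0 + (z 0 0 *: a1 + z 0 1 *: a2).
have gC k : Ck_on k [set: 'rV[R]_2] g.
  apply: (CkD openT); first exact: Ck_cst.
  apply: (CkD openT); apply: (Ck_scale openT); try exact: Ck_cst.
    by apply: (Ck_coord _ openT); exact: (Ck_id _ openT).
  by apply: (Ck_coord _ openT); exact: (Ck_id _ openT).
have g' (z v : 'rV[R]_2) : 'D_v g z = v 0 0 *: a1 + v 0 1 *: a2.
  have d i : is_diff z (fun y : 'rV[R]_2 => y 0 i) (fun v => v 0 i).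
    exact: (is_diff_linear z (@coordL_continuous R 1 i)).
  have := is_diffE v (is_diffD (is_diff_cst x0 z)
    (is_diffD (is_diff_scale (d 0) (is_diff_cst a1 z))
              (is_diff_scale (d 1) (is_diff_cst a2 z)))).
  by rewrite !fctE /= !scaler0 !add0r.
pose U' := [set z | U (g z)].
have oU' : open U'.
  apply: (@open_comp _ _ g) => // z _; exact: (Ck_continuous (gC 0%N)).
have g0 : g 0 = x0 by rewrite /g !mxE !scale0r !addr0.
have U'0 : U' 0 by rewrite /U' /= g0.
have df := Ck_diff Cf Ux0.
have := @local_surjectivity_id 1 (fun z => row2 (f (g z))) U' 0 oU' U'0.
rewrite g0 => H.
have /H{}H : Ck_on 1 U' (fun z => row2 (f (g z))).
  apply: (@Ck_linear_comp _ _ _ _ _ _ L2 (fun z => f (g z)) oU' L2c).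
  apply: (Ck_comp frV oU' oU _ _ Cf) => //.
  exact: (@Ck_sub _ _ _ _ U' [set: 'rV[R]_2]).
have invL (l : {linear V -> (R * R)%type}) (v : 'rV[R]_2) : l v1 = u1 ->
    l v2 = u2 -> row2 (l (v 0 0 *: a1 + v 0 1 *: a2)) = v.
  move=> l1 l2; rewrite /a1 /a2 linear_comb2 l1 l2; exact: row2_inverse.
have {}H : nbhs (row2 (f x0)) [set row2 (f (g z)) | z in U'].
  apply: H => v.
  have dg : is_diff 0 g (fun v => 'D_v g 0) := Ck_diff (gC 1%N) I.
  have df' : is_diff (g 0) f (fun v => 'D_v f x0) by rewrite g0.
  have dfg := is_diff_comp (is_diff_comp dg df') (is_diff_linear _ L2c).
  rewrite (is_diffE v dfg) /= g'.
  have [fd _] := df; rewrite (deriveE _ fd).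
  exact: (invL ('d f x0) v (esym (deriveE v1 fd)) (esym (deriveE v2 fd))).
have hn : nbhs (f x0) [set p | [set row2 (f (g z)) | z in U'] (row2 p)].
  exact: (L2c (f x0) _ H).
apply: filterS hn => p [z Uz pE].
by exists (g z) => //; exact: row2_inj.
Qed.

End LocalSurjectivity.

(** * Surfaces that are coadjoint orbits *)

Section Leaf.
Variables (R : realType) (n : nat) (G : lieGroupType R n).
Local Notation E := 'rV[R]_n.+1.
Variables (br : E -> E -> E) (iota : lie_algebra_iso G br).
Hypothesis Gconn : connected [set: G].
Let c := iso_chart iota.
Let B := iso_mx iota.
Let Bunit : B \in unitmx. Proof. exact: iso_mx_unit. Qed.
Let cA : lie_atlas c. Proof. exact: iso_chart_atlas. Qed.
Let c1 : chart_dom c 1%g. Proof. exact: iso_chart_dom1. Qed.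
Let e := c 1%g.

Definition adstar_mx (A : E) : 'M[R]_n.+1 :=
  \matrix_(j, i) br A (delta_mx 0 i) 0 j.

Lemma adstar_mulmx A F : adstar br A F = F *m adstar_mx A.
Proof. by apply/rowP => i; rewrite !mxE; apply: eq_bigr => j _; rewrite mxE. Qed.

Lemma adstar_mx_continuous i j : continuous (fun A => adstar_mx A j i).
Proof.
have adE A : adstar_mx A j i = 'd (orbit_chart iota (delta_mx 0 j)) e (A *m B) 0 i.
  rewrite (@diff_val _ _ _ _ _ _ _ (is_diff_orbit_chart iota (delta_mx 0 j))).
  rewrite mulmxK// !mxE /pairing (bigD1 j)//= !mxE !eqxx mul1r big1 ?addr0//.
  by move=> k kj; rewrite mxE (negbTE kj) mul0r.
have dk : continuous ('d (orbit_chart iota (delta_mx 0 j)) e).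
  apply: diff_continuous.
  exact: (@ex_diff _ _ _ _ _ _ _ (is_diff_orbit_chart iota (delta_mx 0 j))).
move=> A; rewrite (_ : (fun A => _) = (fun v : E => v 0 i) \o
  ('d (orbit_chart iota (delta_mx 0 j)) e \o mulmxr B)); last first.
  by apply/funext => C; rewrite adE.
apply: continuous_comp; last exact: coord_continuous.
apply: continuous_comp; last exact: dk.
exact: mulmx_continuous.
Qed.

(** A coadjoint curve that starts at F and the constant curve at F solve the same
    linear equation. *)
Lemma coadjoint_orbit_trivial F : (forall A A', pairing F (br A A') = 0) ->
  coadjoint_orbit iota F = [set F].
Proof.
move=> F0; apply/seteqP; split; last first.
  by move=> _ ->; exists 1%g => //; exact: coadjoint1.
apply: (coadjoint_orbit_sub Gconn) => // k A [kD Ac] k0.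
have adF A' : F *m adstar_mx A' = 0.
  by rewrite -adstar_mulmx; apply/rowP => i; rewrite !mxE.
have pi2 : 0 <= pi / 2 :> R by rewrite divr_ge0// pi_ge0.
have := @linear_ode_unique R _ (fun s => k s - F) (fun s => adstar_mx (A s))
  _ _ _ _ pi2.
move=> H; apply/eqP; rewrite -subr_eq0; apply/eqP/H => {H}.
- move=> i j s.
  exact: (@continuous_comp _ _ _ A (fun A => adstar_mx A i j) s (Ac s)
    (@adstar_mx_continuous j i (A s))).
- move=> s _; rewrite mulmxBl adF subr0 -adstar_mulmx -[X in is_derive _ _ _ X]subr0.
  exact: is_deriveB.
- by rewrite k0 subrr.
Qed.

Lemma coadjoint_orbit_shift F F' : coadjoint_orbit iota F F' ->
  forall F'', coadjoint_orbit iota F F'' <-> coadjoint_orbit iota F' F''.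
Proof.
move=> [g _ gF] F''; split=> -[h _ hF].
  exists (h * g^-1)%g; first exact: I.
  apply: (etrans (coadjointM iota h g^-1%g F')); apply: etrans hF.
  apply: (congr1 (coadjoint iota h)); apply: etrans (coadjointK iota g F).
  exact: (congr1 (coadjoint iota g^-1%g) (esym gF)).
exists (h * g)%g; first exact: I.
apply: (etrans (coadjointM iota h g F)); apply: etrans hF.
exact: (congr1 (coadjoint iota h) gF).
Qed.

(** A parametrized surface; eta A x is the vector of the plane that the
    differential of psi sends to xi_A, and eta_wedge says that the Kirillov form is
    dp /\ dq. *)
Variables (psi : R * R -> E) (eta : E -> R * R -> R * R).
Hypothesis psiC : smooth_on [set: R * R] psi.
Hypothesis psi_inv : forall x, exists (U : set E) (phi : E -> R * R),
  [/\ open U, U (psi x), smooth_on U phi &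
      forall z, U (psi z) -> phi (psi z) = z].
Hypothesis psi_eta : forall A x, 'D_(eta A x) psi x = adstar br A (psi x).
Hypothesis eta_wedge : forall A A' x,
  wedge (eta A x) (eta A' x) = pairing (psi x) (br A A').
Hypothesis nondeg : forall x, exists A A', pairing (psi x) (br A A') != 0.
Hypothesis curve_leaf : forall k A, coadjoint_curve br k A ->
  range psi (k 0) -> range psi (k (pi / 2)).

Let psi_diff x : is_diff x psi (fun v => 'D_v psi x).
Proof. exact: (Ck_diff (psiC 1%N) I). Qed.

Lemma psi_injective : injective psi.
Proof.
move=> x y xy; have [U [phi [_ Ux _ phiK]]] := psi_inv x.
by rewrite -(phiK x)// xy phiK// -xy.
Qed.

Lemma psi_inv_diff x (U : set E) (phi : E -> R * R) : open U -> U (psi x) ->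
  smooth_on U phi -> (forall z, U (psi z) -> phi (psi z) = z) ->
  forall v, 'D_('D_v psi x) phi (psi x) = v.
Proof.
move=> oU Ux phiC phiK v.
have dphi := Ck_diff (phiC 1%N) Ux.
have dcomp := is_diff_comp (psi_diff x) dphi.
have psic : {for x, continuous psi} := Ck_continuous (psiC 0%N) I.
have idE : \forall z \near x, (phi \o psi) z = id z.
  have hn : nbhs x [set z | U (psi z)].
    exact: (psic _ (open_nbhs_nbhs (conj oU Ux))).
  by apply: filterS hn => z /phiK.
have := is_diffE v (near_eq_is_diff idE dcomp).
by rewrite derive_id.
Qed.

Lemma coadjoint_orbit_sub_leaf x : coadjoint_orbit iota (psi x) `<=` range psi.
Proof. by apply: coadjoint_orbit_sub => //; exists x. Qed.

(** In the coordinates phi of the surface, h |-> K(h^-1) (psi x) has the derivative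
    A |-> eta A x at 1.  Two vectors A and A' on which the Kirillov form is not
    zero are sent to a basis of the plane. *)
Lemma coadjoint_orbit_near x :
  \forall z \near x, coadjoint_orbit iota (psi x) (psi z).
Proof.
have [U [phi [oU Ux phiC phiK]]] := psi_inv x.
have [A [A' AA']] := nondeg x.
pose k := orbit_chart iota (psi x).
have kC m : Ck_on m (Ad_dom c) k by exact: Ck_orbit_chart.
have oAd : open (Ad_dom c) by exact: open_Ad_dom.
have ke : k e = psi x by exact: orbit_chart_unit.
pose V : set E := [set y | Ad_dom c y /\ U (k y)].
have oV : open V.
  by apply: open_setI_preimage => // y; exact: (Ck_continuous (kC 0%N)).
have Ve : V e by split; [exact: Ad_dom_unit|rewrite ke].
have fC : Ck_on 1 V (phi \o k).
  apply: (Ck_comp (@frame_row R n) oV oU _ _ (phiC 1%N)); first by move=> y [].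
  by apply: Ck_sub (kC 1%N) => y [].
have f' C : 'D_(C *m B) (phi \o k) e = eta C x.
  have dphi : is_diff (k e) phi (fun v => 'D_v phi (psi x)).
    by rewrite ke; exact: (Ck_diff (phiC 1%N) Ux).
  rewrite (is_diffE _ (is_diff_comp (is_diff_orbit_chart iota (psi x)) dphi)) /=.
  by rewrite mulmxK// -psi_eta (psi_inv_diff oU Ux phiC phiK).
have := @local_surjectivity R E (phi \o k) V e (A *m B) (A' *m B) (@frame_row R n) oV Ve fC.
rewrite !f' eta_wedge => /(_ AA'); rewrite /= ke phiK//.
apply: filterS => z [y [_ Uy] <-] /=.
have ky : coadjoint_orbit iota (psi x) (k y) by exists (chart_inv c y)^-1%g.
have [z' _ z'E] := coadjoint_orbit_sub_leaf ky.
by rewrite -z'E phiK// z'E.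
Qed.

(** By [coadjoint_orbit_near] the points of the plane that psi sends to a given
    orbit form an open set with an open complement. *)
Lemma coadjoint_orbit_leaf x : coadjoint_orbit iota (psi x) = range psi.
Proof.
apply/seteqP; split; first exact: coadjoint_orbit_sub_leaf.
move=> _ [z _ <-].
pose g (t : R) : R * R := x + t *: (z - x).
have gc : continuous g.
  have gC : Ck_on 0 [set: R] g.
    apply: (CkD openT); first exact: Ck_cst.
    by apply: (Ck_scale openT); [exact: (Ck_id _ openT)|exact: Ck_cst].
  by move=> t; exact: (gC t I).
have Rconn : connected [set: R] by apply/connected_intervalP.
have g0 : g 0 = x by rewrite /g scale0r addr0.
have g1 : g 1 = z by rewrite /g scale1r subrKC.
rewrite -g1; apply: (@connected_locally_constant R
  (fun t => coadjoint_orbit iota (psi x) (psi (g t))) 0 Rconn); last first.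
  by rewrite g0; exists 1%g => //; exact: coadjoint1.
move=> t; have hn : nbhs t [set s | coadjoint_orbit iota (psi (g t)) (psi (g s))].
  exact: (gc t _ (coadjoint_orbit_near (g t))).
apply: filterS hn => s gs; split=> gx.
  by apply: (coadjoint_orbit_shift gx _).2.
apply: (coadjoint_orbit_shift gx _).2.
apply: (coadjoint_orbit_shift gs _).1.
by exists 1%g => //; exact: coadjoint1.
Qed.

Theorem leaf_orbit x0 :
  diffeomorphism_onto (coadjoint_orbit iota (psi x0)) psi /\
  exists2 omega : E -> E -> E -> R,
    Kirillov_form iota (coadjoint_orbit iota (psi x0)) omega &
    forall x u v : R * R, omega (psi x) ('d psi x u) ('d psi x v)
      = u.1 * v.2 - v.1 * u.2.
Proof.
rewrite coadjoint_orbit_leaf; split.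
  split; first exact: psiC.
    by split=> [z _|z z' _ _|_ [z _ <-]]; [exists z|exact: psi_injective|exists z].
  by move=> _ [x _ <-]; have [U [phi [? ? ? ?]]] := psi_inv x; exists U, phi.
(* D is the inverse of the differential of psi *)
pose D F v := xget 0 [set u | exists2 x, psi x = F & 'D_u psi x = v].
have DE x u : D (psi x) ('D_u psi x) = u.
  rewrite /D; case: xgetP => [w _ [y /psi_injective -> yE]|/(_ u) []].
    have [U [phi [oU Ux phiC phiK]]] := psi_inv x.
    by rewrite -(psi_inv_diff oU Ux phiC phiK w) yE (psi_inv_diff oU Ux phiC phiK).
  by exists x.
have dE x u : 'd psi x u = 'D_u psi x.
  by rewrite deriveE//; case: (psi_diff x).
exists (fun F v w => wedge (D F v) (D F w)); last first.
  by move=> x u v; rewrite !dE !DE.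
have DA A x : D (psi x) (adstar br A (psi x)) = eta A x by rewrite -psi_eta DE.
move=> _ A A' v w [x _ <-] /fundamental_vectorE -> /fundamental_vectorE ->.
by rewrite !DA; exact: eta_wedge.
Qed.

End Leaf.

(** * Cylinders and saddles *)

Section Row4.
Variable R : realType.
Local Notation E := 'rV[R]_4.

Definition row4 (x y z t : R) : E := \row_i [:: x; y; z; t]`_i.

Lemma ord4P (P : 'I_4 -> Prop) : P 0 -> P 1 -> P 2 -> P 3 -> forall i, P i.
Proof.
move=> P0 P1 P2 P3; case=> [[|[|[|[|//]]]] ip].
- by have <- : 0 = Ordinal ip by exact: val_inj.
- by have <- : 1 = Ordinal ip by exact: val_inj.
- by have <- : 2 = Ordinal ip by exact: val_inj.
- by have <- : 3 = Ordinal ip by exact: val_inj.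
Qed.

Lemma row4_ext (u v : E) : u 0 0 = v 0 0 -> u 0 1 = v 0 1 -> u 0 2 = v 0 2 ->
  u 0 3 = v 0 3 -> u = v.
Proof. by move=> *; apply/rowP; apply: ord4P. Qed.

Lemma row4E x y z t : (row4 x y z t 0 0 = x) * (row4 x y z t 0 1 = y) *
  (row4 x y z t 0 2 = z) * (row4 x y z t 0 3 = t).
Proof. by rewrite !mxE. Qed.

Lemma Ck_row4 (V : normedModType R) k (U : set V) (x y z t : V -> R) : open U ->
  Ck_on k U x -> Ck_on k U y -> Ck_on k U z -> Ck_on k U t ->
  Ck_on k U (fun v => row4 (x v) (y v) (z v) (t v)).
Proof.
move=> oU Cx Cy Cz Ct; apply: (Ck_row oU); apply: ord4P.
- by apply: (Ck_ext oU _ Cx) => v _; rewrite row4E.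
- by apply: (Ck_ext oU _ Cy) => v _; rewrite row4E.
- by apply: (Ck_ext oU _ Cz) => v _; rewrite row4E.
- by apply: (Ck_ext oU _ Ct) => v _; rewrite row4E.
Qed.

Lemma is_diff_row4 (V : normedModType R) (x y z t dx dy dz dt : V -> R) (v : V) :
  is_diff v x dx -> is_diff v y dy -> is_diff v z dz -> is_diff v t dt ->
  is_diff v (fun v => row4 (x v) (y v) (z v) (t v))
    (fun u => row4 (dx u) (dy u) (dz u) (dt u)).
Proof.
have E4 (a b c d : R) : a *: delta_mx 0 0 + (b *: delta_mx 0 1 +
    (c *: delta_mx 0 2 + d *: delta_mx 0 3)) = row4 a b c d.
  by apply: row4_ext; rewrite row4E !mxE /= ?mulr1 ?mulr0 ?addr0 ?add0r.
move=> hx hy hz ht.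
have hs (f df : V -> R) (w : E) : is_diff v f df ->
    is_diff v (fun u => f u *: w) (fun u => df u *: w).
  move=> hf; have := is_diff_scale hf (is_diff_cst w v).
  by congr is_diff_def; apply/funext => u; rewrite /= scaler0 add0r.
have := is_diffD (hs _ _ (delta_mx 0 0) hx) (is_diffD (hs _ _ (delta_mx 0 1) hy)
  (is_diffD (hs _ _ (delta_mx 0 2) hz) (hs _ _ (delta_mx 0 3) ht))).
by congr is_diff_def; apply/funext => u; rewrite -E4.
Qed.

End Row4.

Lemma pairing4 (R : realType) (F A : 'rV[R]_4) : pairing F A =
  F 0 0 * A 0 0 + F 0 1 * A 0 1 + F 0 2 * A 0 2 + F 0 3 * A 0 3.
Proof.
rewrite /pairing !big_ord_recr big_ord0 /= add0r.
by congr (_ + _ + _ + _); congr (_ * _); congr (_ 0 _); exact: val_inj.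
Qed.

Definition canonical_coordinates (R : realType) (G : lieGroupType R 3)
    (br : 'rV[R]_4 -> 'rV[R]_4 -> 'rV[R]_4) (iota : lie_algebra_iso G br)
    (F : 'rV[R]_4) : Prop :=
  exists psi : R * R -> 'rV[R]_4,
    [/\ diffeomorphism_onto (coadjoint_orbit iota F) psi,
        forall A : 'rV[R]_4, exists Phi Psi : R -> R,
          [/\ smooth_on [set: R] Phi, smooth_on [set: R] Psi &
              forall p q, pairing (psi (p, q)) A = Phi q * p + Psi q] &
        exists2 omega : 'rV[R]_4 -> 'rV[R]_4 -> 'rV[R]_4 -> R,
          Kirillov_form iota (coadjoint_orbit iota F) omega &
          forall x u v : R * R,
            omega (psi x) ('d psi x u) ('d psi x v)
              = u.1 * v.2 - v.1 * u.2].

Section CylinderLeaf.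
Variables (R : realType) (G : lieGroupType R 3).
Local Notation E := 'rV[R]_4.
Variables (br : E -> E -> E) (iota : lie_algebra_iso G br).
Hypothesis Gconn : connected [set: G].

Variables x y z x' y' z' : R -> R.
Hypotheses (xD : forall q, is_derive q (1 : R) x (x' q))
  (yD : forall q, is_derive q (1 : R) y (y' q))
  (zD : forall q, is_derive q (1 : R) z (z' q)).
Hypotheses (xC : smooth_on [set: R] x) (yC : smooth_on [set: R] y)
  (zC : smooth_on [set: R] z).

(** The point with coordinate p on T over the point of parameter q of the curve
    (x, y, z). *)
Definition cylinder (pq : R * R) : E := row4 (x pq.2) (y pq.2) (z pq.2) pq.1.

(** Along the cylinder the brackets among X, Y and Z are annihilated, and
    (x', y', z') is the restriction of F \o ad T. *)
Hypothesis pairing_br : forall pq A A', pairing (cylinder pq) (br A A') =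
  (A 0 3 * A' 0 0 - A 0 0 * A' 0 3) * x' pq.2 +
  (A 0 3 * A' 0 1 - A 0 1 * A' 0 3) * y' pq.2 +
  (A 0 3 * A' 0 2 - A 0 2 * A' 0 3) * z' pq.2.

Hypothesis tau_ex : exists (U : set E) (tau : E -> R),
  [/\ open U, smooth_on U tau &
      forall pq, U (cylinder pq) /\ tau (cylinder pq) = pq.2].

Let eta (A : E) (pq : R * R) : R * R :=
  (- (A 0 0 * x' pq.2 + A 0 1 * y' pq.2 + A 0 2 * z' pq.2), A 0 3).

Lemma cylinder_smooth : smooth_on [set: R * R] cylinder.
Proof.
have sndC : Ck_on _ [set: R * R] snd := Ck_snd _ openT.
move=> k; apply: (Ck_row4 openT).
- exact: (Ck_comp (frame_real R) openT openT _ (sndC k) (xC k)).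
- exact: (Ck_comp (frame_real R) openT openT _ (sndC k) (yC k)).
- exact: (Ck_comp (frame_real R) openT openT _ (sndC k) (zC k)).
- exact: (Ck_fst _ openT).
Qed.

Lemma cylinder_derive u pq : 'D_u cylinder pq =
  row4 (u.2 * x' pq.2) (u.2 * y' pq.2) (u.2 * z' pq.2) u.1.
Proof.
have d2 : is_diff pq snd (snd : R * R -> R).
  by apply: (@is_diff_linear _ (R * R)%type R snd) => v; exact: cvg_snd.
have d1 : is_diff pq fst (fst : R * R -> R).
  by apply: (@is_diff_linear _ (R * R)%type R fst) => v; exact: cvg_fst.
have dc (f f' : R -> R) : (forall q, is_derive q (1 : R) f (f' q)) ->
    is_diff pq (f \o snd) (fun u => u.2 * f' pq.2).
  by move=> fD; exact: (is_diff_comp d2 (is_derive_diff (fD pq.2))).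
exact: (is_diffE u (is_diff_row4 (dc _ _ xD) (dc _ _ yD) (dc _ _ zD) d1)).
Qed.

Lemma cylinder_adstar A pq : adstar br A (cylinder pq) =
  row4 (A 0 3 * x' pq.2) (A 0 3 * y' pq.2) (A 0 3 * z' pq.2)
    (- (A 0 0 * x' pq.2 + A 0 1 * y' pq.2 + A 0 2 * z' pq.2)).
Proof.
by apply: row4_ext; rewrite row4E mxE pairing_br !mxE /=; ring.
Qed.

(** A coadjoint curve moves over (x, y, z) with the velocity A s 0 3 in the
    parameter.  The comparison curve g does so by construction and copies the last
    coordinate; the difference of the two curves solves the linear equation given
    by N, which is ad (A s) with its last coordinate set to 0. *)
Lemma cylinder_curve k A : coadjoint_curve br k A ->
  range cylinder (k 0) -> range cylinder (k (pi / 2)).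
Proof.
move=> [kD Ac] [[p0 q0] _ k0].
have [b b0 bD] := @continuous_antiderivative R (fun s => A s 0 3)
  (fun s => @continuous_comp _ _ _ A (fun v : E => v 0 3) s (Ac s)
     (@coord_continuous _ _ _ _ _ _)).
pose N s : 'M[R]_4 := \matrix_(j, i) if i == 3 then 0 else adstar_mx br (A s) j i.
pose g s := cylinder (k s 0 3, q0 + b s).
have wE : forall t, 0 <= t -> k t - g t = 0.
  apply: (@linear_ode_unique R _ _ N).
  - move=> i j s; rewrite (_ : (fun s => N s i j) =
      fun s => if j == 3 then 0 else adstar_mx br (A s) i j); last first.
      by apply/funext => t; rewrite mxE.
    case: (j == 3); first exact: cst_continuous.
    exact: (@continuous_comp _ _ _ A (fun A => adstar_mx br A i j) s (Ac s)
      (@adstar_mx_continuous _ _ _ _ iota j i (A s))).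
  - move=> s s1.
    have k3 : is_derive s (1 : R) (fun t => k t 0 3) (adstar br (A s) (k s) 0 3).
      by have /is_derive_row := kD s; apply.
    have qs : is_derive s (1 : R) (fun t => q0 + b t) (A s 0 3).
      by rewrite -[A s 0 3]add0r; apply: is_deriveD; exact: bD.
    have gD : is_derive s (1 : R) g
        (row4 (A s 0 3 * x' (q0 + b s)) (A s 0 3 * y' (q0 + b s))
              (A s 0 3 * z' (q0 + b s)) (adstar br (A s) (k s) 0 3)).
      have pD := is_diff_pair (is_derive_diff k3) (is_derive_diff qs).
      have := is_diff_derive (1 : R)
        (is_diff_comp pD (Ck_diff (cylinder_smooth 1%N) I)).
      by rewrite /= cylinder_derive /= !scale1r.
    have := is_deriveB (kD s) gD; congr is_derive.
    have gs : adstar br (A s) (g s) = g s *m adstar_mx br (A s).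
      exact: adstar_mulmx.
    have NE v (i : 'I_4) : (v *m N s) 0 i = if i == 3 then 0
        else adstar br (A s) v 0 i.
      rewrite adstar_mulmx !mxE; case: ifP => i3.
        by rewrite big1// => j _; rewrite mxE i3 mulr0.
      by apply: eq_bigr => j _; rewrite [in LHS]mxE i3.
    have gA : adstar br (A s) (g s) = row4 (A s 0 3 * x' (q0 + b s))
        (A s 0 3 * y' (q0 + b s)) (A s 0 3 * z' (q0 + b s))
        (- (A s 0 0 * x' (q0 + b s) + A s 0 1 * y' (q0 + b s) +
            A s 0 2 * z' (q0 + b s))).
      exact: cylinder_adstar.
    have subE (u v : E) i : (u - v) 0 i = u 0 i - v 0 i by rewrite !mxE.
    rewrite mulmxBl; apply: row4_ext; rewrite !subE !NE /= ?gA !row4E //.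
    by rewrite !subrr.
  rewrite /g b0 addr0 -k0 /cylinder /= row4E; exact: subrr.
exists (k (pi / 2) 0 3, q0 + b (pi / 2)); first exact: I.
apply/esym/eqP; rewrite -subr_eq0; apply/eqP/wE.
by rewrite divr_ge0// pi_ge0.
Qed.

Lemma cylinder_inv pq : exists (U : set E) (phi : E -> R * R),
  [/\ open U, U (cylinder pq), smooth_on U phi &
      forall rs, U (cylinder rs) -> phi (cylinder rs) = rs].
Proof.
have [U [tau [oU tauC tauK]]] := tau_ex.
exists U, (fun u : E => (u 0 3, tau u)); split=> //.
- by case: (tauK pq).
- move=> k; apply: (Ck_pair oU _ (tauC k)).
  by apply: (Ck_coord _ oU); exact: (Ck_id _ oU).
- by move=> [r s] _; rewrite /= (tauK (r, s)).2 /cylinder row4E.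
Qed.

(** The inverse of the parametrization shows that (x', y', z') does not vanish. *)
Lemma cylinder_nondeg pq : exists A A', pairing (cylinder pq) (br A A') != 0.
Proof.
have [U [phi [oU Ux phiC phiK]]] := cylinder_inv pq.
have dphi := psi_inv_diff cylinder_smooth oU Ux phiC phiK (0, 1).
apply: contrapT => nd.
have pE i : pairing (cylinder pq) (br (delta_mx 0 3) (delta_mx 0 i)) = 0.
  by apply: contrapT => /eqP pn0; apply: nd; exists (delta_mx 0 3), (delta_mx 0 i).
move: (pE 0) (pE 1) (pE 2); rewrite !pairing_br !mxE /= => x0 y0 z0.
have {}x0 : x' pq.2 = 0 by rewrite -x0; ring.
have {}y0 : y' pq.2 = 0 by rewrite -y0; ring.
have {}z0 : z' pq.2 = 0 by rewrite -z0; ring.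
move: dphi; rewrite cylinder_derive x0 y0 z0 !mulr0.
have -> : row4 0 0 0 0 = 0 :> E by apply: row4_ext; rewrite row4E mxE.
by rewrite derive0 => -[] /esym/eqP; rewrite oner_eq0.
Qed.

Theorem cylinder_orbit pq : canonical_coordinates iota (cylinder pq).
Proof.
have etaE A rs : 'D_(eta A rs) cylinder rs = adstar br A (cylinder rs).
  by rewrite cylinder_derive cylinder_adstar.
have etaW A A' rs : wedge (eta A rs) (eta A' rs) = pairing (cylinder rs) (br A A').
  by rewrite pairing_br /wedge /=; ring.
have [diffeo omega] := leaf_orbit iota Gconn cylinder_smooth cylinder_inv etaE etaW
  cylinder_nondeg cylinder_curve pq.
exists cylinder; split=> // A.
exists (fun=> A 0 3), (fun q => x q * A 0 0 + y q * A 0 1 + z q * A 0 2); split.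
- by move=> k; exact: Ck_cst.
- move=> k; apply: (CkD openT); [apply: (CkD openT)|];
    by apply: (CkM openT); [|exact: Ck_cst].
- by move=> p q; rewrite pairing4 /cylinder !row4E /=; ring.
Qed.

End CylinderLeaf.

Section SaddleLeaf.
Variables (R : realType) (G : lieGroupType R 3).
Local Notation E := 'rV[R]_4.
Variables (br : E -> E -> E) (iota : lie_algebra_iso G br).
Hypothesis Gconn : connected [set: G].
Hypothesis pairing_br : forall F A A', pairing F (br A A') =
  - (A 0 3 * A' 0 0 - A 0 0 * A' 0 3) * F 0 0 +
  (A 0 3 * A' 0 1 - A 0 1 * A' 0 3) * F 0 1 +
  (A 0 0 * A' 0 1 - A 0 1 * A' 0 0) * F 0 2.

Variables g d : R.
Hypothesis g0 : g != 0.

(** The factor g in the first coordinate makes the Kirillov form dp /\ dq. *)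
Definition saddle (pq : R * R) : E :=
  row4 (g * pq.1) pq.2 g (d + pq.1 * pq.2).

Let eta (A : E) (pq : R * R) : R * R :=
  (- (A 0 3 * pq.1 + A 0 1), A 0 3 * pq.2 + A 0 0 * g).

Lemma saddle_smooth : smooth_on [set: R * R] saddle.
Proof.
have sndC k : Ck_on k [set: R * R] snd := Ck_snd _ openT.
have fstC k : Ck_on k [set: R * R] fst := Ck_fst _ openT.
move=> k; apply: (Ck_row4 openT).
- by apply: (CkM openT); [exact: Ck_cst|exact: fstC].
- exact: sndC.
- exact: Ck_cst.
- apply: (CkD openT); first exact: Ck_cst.
  by apply: (CkM openT); [exact: fstC|exact: sndC].
Qed.

Lemma saddle_derive u pq : 'D_u saddle pq =
  row4 (g * u.1) u.2 0 (pq.1 * u.2 + u.1 * pq.2).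
Proof.
have d2 : is_diff pq snd (snd : R * R -> R).
  by apply: (@is_diff_linear _ (R * R)%type R snd) => v; exact: cvg_snd.
have d1 : is_diff pq fst (fst : R * R -> R).
  by apply: (@is_diff_linear _ (R * R)%type R fst) => v; exact: cvg_fst.
have dcst (a : R) : is_diff pq (fun=> a) (fun=> 0 : R) := is_diff_cst a pq.
have dM := is_diff_scale d1 d2.
have d4 : is_diff pq (fun z => d + z.1 * z.2)
    (fun u => 0 + (pq.1 * u.2 + u.1 * pq.2)) := is_diffD (dcst d) dM.
rewrite (is_diffE u (is_diff_row4 (is_diff_scale (dcst g) d1) d2 (dcst g) d4)).
by apply: row4_ext; rewrite !row4E /= /GRing.scale /=; ring.
Qed.

Lemma adstar_saddle A F : adstar br A F =
  row4 (- (A 0 3 * F 0 0 + A 0 1 * F 0 2)) (A 0 3 * F 0 1 + A 0 0 * F 0 2) 0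
    (A 0 0 * F 0 0 - A 0 1 * F 0 1).
Proof. by apply: row4_ext; rewrite row4E mxE pairing_br !mxE /=; ring. Qed.

(** The value g on Z and F X * F Y - F Z * F T are constant along coadjoint
    curves. *)
Lemma saddle_curve k A : coadjoint_curve br k A ->
  range saddle (k 0) -> range saddle (k (pi / 2)).
Proof.
move=> [kD _] [[p0 q0] _ k0].
have kiD s i : is_derive s (1 : R) (fun t => k t 0 i) (adstar br (A s) (k s) 0 i).
  by have /is_derive_row := kD s; apply.
have k2 s : k s 0 2 = g.
  rewrite -[RHS](_ : k 0 0 2 = g); last by rewrite -k0 row4E.
  apply: (@is_derive_0_is_cst _ (fun t => k t 0 2)) => t.
  by have := kiD t 2; rewrite adstar_saddle row4E.
have inv s : k s 0 0 * k s 0 1 - k s 0 2 * k s 0 3 = - g * d.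
  rewrite -[RHS](_ : k 0 0 0 * k 0 0 1 - k 0 0 2 * k 0 0 3 = - g * d); last first.
    by rewrite -k0 !row4E /=; ring.
  apply: (@is_derive_0_is_cst _
    (fun t => k t 0 0 * k t 0 1 - k t 0 2 * k t 0 3)) => t.
  have := is_deriveB (is_deriveM (kiD t 0) (kiD t 1))
    (is_deriveM (kiD t 2) (kiD t 3)).
  by congr is_derive; rewrite adstar_saddle !row4E /GRing.scale /=; ring.
exists (k (pi / 2) 0 0 / g, k (pi / 2) 0 1); first exact: I.
have := inv (pi / 2); rewrite k2 => invE.
apply: row4_ext; rewrite row4E //=; first by rewrite mulrC divfK.
apply: (mulfI g0); rewrite mulrDr mulrA [g * (_ / g)]mulrC divfK//.
apply/eqP; rewrite -subr_eq0; apply/eqP.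
by rewrite -[RHS](subrr (- g * d)) -{1}invE; ring.
Qed.

Theorem saddle_orbit pq : canonical_coordinates iota (saddle pq).
Proof.
have etaE A rs : 'D_(eta A rs) saddle rs = adstar br A (saddle rs).
  by rewrite saddle_derive adstar_saddle; apply: row4_ext; rewrite !row4E /=; ring.
have etaW A A' rs : wedge (eta A rs) (eta A' rs) = pairing (saddle rs) (br A A').
  by rewrite pairing_br /wedge !row4E /=; ring.
have sinv rs : exists (U : set E) (phi : E -> R * R),
    [/\ open U, U (saddle rs), smooth_on U phi &
        forall z, U (saddle z) -> phi (saddle z) = z].
  have cC k i : Ck_on k [set: E] (fun u : E => u 0 i).
    by apply: (Ck_coord _ openT); exact: (Ck_id _ openT).
  exists setT, (fun u : E => (g^-1 * u 0 0, u 0 1)); split=> //; first exact: openT.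
  - move=> k; apply: (Ck_pair openT); last exact: cC.
    by apply: (CkM openT); [exact: Ck_cst|exact: cC].
  - by move=> [p q] _; rewrite !row4E /= mulKf.
have nondeg rs : exists A A', pairing (saddle rs) (br A A') != 0.
  exists (delta_mx 0 0), (delta_mx 0 1); rewrite pairing_br !row4E !mxE /=.
  by rewrite !(mul0r, mulr0, mulr1, mul1r, subr0, oppr0, add0r, addr0).
have [diffeo omega] := leaf_orbit iota Gconn saddle_smooth sinv etaE etaW nondeg
  saddle_curve pq.
exists saddle; split=> // A.
exists (fun q => g * A 0 0 + q * A 0 3),
  (fun q => q * A 0 1 + (g * A 0 2 + d * A 0 3)); split.
- move=> k; apply: (CkD openT); first exact: Ck_cst.
  by apply: (CkM openT); [exact: (Ck_id _ openT)|exact: Ck_cst].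
- move=> k; apply: (CkD openT); last exact: Ck_cst.
  by apply: (CkM openT); [exact: (Ck_id _ openT)|exact: Ck_cst].
- by move=> p q; rewrite pairing4 !row4E /=; ring.
Qed.

End SaddleLeaf.

(** * Solutions of u' = u \o ad T *)

Section Curves.
Variable R : realType.

(** Solutions for a real eigenvalue m; a Jordan block of size at most 3 gives
    polynomials of degree at most 2. *)
Definition expoly (m a b c q : R) : R := expR (m * q) * (a + b * q + c * (q * q)).

(** Solutions for the eigenvalues m + i w and m - i w. *)
Definition spiral (m w a b q : R) : R :=
  expR (m * q) * (a * cos (w * q) - b * sin (w * q)).

Lemma expoly0 m a b c : expoly m a b c 0 = a.
Proof. by rewrite /expoly !mulr0 expR0 !addr0 mul1r. Qed.

Lemma spiral0 m w a b : spiral m w a b 0 = a.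
Proof. by rewrite /spiral !mulr0 expR0 cos0 sin0 mulr1 mulr0 subr0 mul1r. Qed.

Lemma is_derive_scaled (f f' : R -> R) (m q : R) :
  (forall x, is_derive x (1 : R) f (f' x)) ->
  is_derive q (1 : R) (fun q => f (m * q)) (m * f' (m * q)).
Proof.
move=> fD; have mq : is_derive q (1 : R) (fun q => m * q) m.
  by have := is_deriveZ m (is_derive_id q (1 : R)); rewrite /GRing.scale /= mulr1.
by rewrite mulrC; exact: (is_derive1_comp (fD (m * q)) mq).
Qed.

Lemma is_derive_expoly m a b c q : is_derive q (1 : R) (expoly m a b c)
  (m * expoly m a b c q + expoly m b (2 * c) 0 q).
Proof.
have eD := is_derive_scaled m q (@is_derive_expR R).
have iD := is_derive_id q (1 : R).
have pD : is_derive q (1 : R) (fun q => a + b * q + c * (q * q)) (b + 2 * c * q).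
  have := is_deriveD (is_deriveD (is_derive_cst a q (1 : R)) (is_deriveZ b iD))
    (is_deriveZ c (is_deriveM iD iD)).
  by congr is_derive; rewrite /GRing.scale /=; ring.
have := is_deriveM eD pD; congr is_derive.
by rewrite /expoly /GRing.scale /=; ring.
Qed.

Lemma is_derive_spiral m w a b q : is_derive q (1 : R) (spiral m w a b)
  (m * spiral m w a b q - w * spiral m w b (- a) q).
Proof.
have eD := is_derive_scaled m q (@is_derive_expR R).
have cD := is_derive_scaled w q (@is_derive_cos R).
have sD := is_derive_scaled w q (@is_derive_sin R).
have rD : is_derive q (1 : R) (fun q => a * cos (w * q) - b * sin (w * q))
    (a * (w * - sin (w * q)) - b * (w * cos (w * q))).
  exact: (is_deriveB (is_deriveZ a cD) (is_deriveZ b sD)).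
have := is_deriveM eD rD.
by congr is_derive; rewrite /spiral /GRing.scale /=; ring.
Qed.

Lemma expoly_smooth m a b c : smooth_on [set: R] (expoly m a b c).
Proof.
move=> k; have qC : Ck_on k [set: R] (fun q : R => q) := Ck_id _ openT.
have cC d : Ck_on k [set: R] (fun=> d : R) by exact: Ck_cst.
apply: (CkM openT); first by apply: (Ck_expR openT); exact: (CkM openT).
apply: (CkD openT); last by apply: (CkM openT) => //; exact: (CkM openT).
by apply: (CkD openT) => //; exact: (CkM openT).
Qed.

Lemma spiral_smooth m w a b : smooth_on [set: R] (spiral m w a b).
Proof.
move=> k; have qC : Ck_on k [set: R] (fun q : R => q) := Ck_id _ openT.
have cC d : Ck_on k [set: R] (fun=> d : R) by exact: Ck_cst.
have [cosC sinC] := Ck_trigo openT (CkM openT (cC w) qC).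
apply: (CkM openT); first by apply: (Ck_expR openT); exact: (CkM openT).
apply: (CkD openT); first exact: (CkM openT).
by apply: (CkN openT); exact: (CkM openT).
Qed.

(** A function that is multiplied by e^(m q) along the curve gives the time q as a
    logarithm. *)
Lemma log_time (E : normedModType R) (C : R * R -> E) (Q : E -> R) (m Q0 : R) :
  smooth_on [set: E] Q -> m != 0 -> Q0 != 0 ->
  (forall pq, Q (C pq) = Q0 * expR (m * pq.2)) ->
  exists (U : set E) (tau : E -> R), [/\ open U, smooth_on U tau &
    forall pq, U (C pq) /\ tau (C pq) = pq.2].
Proof.
move=> QC m0 Q00 QE; pose q u := Q0^-1 * Q u.
have qC k : Ck_on k [set: E] q by apply: (CkM openT); [exact: Ck_cst|exact: QC].
have qE pq : q (C pq) = expR (m * pq.2) by rewrite /q QE mulKf.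
pose U := [set u | 0 < q u].
have oU : open U.
  apply: (@open_comp _ _ q [set x : R | 0 < x]); last exact: open_gt.
  by move=> u _; exact: (Ck_continuous (qC 0%N)).
exists U, (fun u => m^-1 * ln (q u)); split=> //.
  move=> k; apply: (CkM oU); first exact: Ck_cst.
  by apply: (Ck_ln oU) => //; exact: Ck_sub (qC k).
by move=> pq; rewrite /U /= qE expR_gt0 expRK mulKf.
Qed.

Lemma pairing_bracket4 (L : solvable4 R) (TX TY TZ XY F A A' : 'rV[R]_4) :
  basis_brackets L = (TX, TY, TZ, XY) ->
  pairing F (bracket4 L A A') =
    (A 0 3 * A' 0 0 - A 0 0 * A' 0 3) * pairing F TX +
    (A 0 3 * A' 0 1 - A 0 1 * A' 0 3) * pairing F TY +
    (A 0 3 * A' 0 2 - A 0 2 * A' 0 3) * pairing F TZ +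
    (A 0 0 * A' 0 1 - A 0 1 * A' 0 0) * pairing F XY.
Proof.
rewrite /bracket4 => ->; rewrite -[pairing F]/(pairingL F : _ -> _).
have Z a u : pairingL F (a *: u) = a * pairingL F u by exact: linearZ.
by rewrite !linearD !Z.
Qed.

Lemma coord_smooth i : smooth_on [set: 'rV[R]_4] (fun u => u 0 i).
Proof. by move=> k; apply: (Ck_coord _ openT); exact: (Ck_id _ openT). Qed.

Lemma sqr_smooth i j :
  smooth_on [set: 'rV[R]_4] (fun u => u 0 i * u 0 i + u 0 j * u 0 j).
Proof.
by move=> k; apply: (CkD openT); apply: (CkM openT); exact: coord_smooth.
Qed.

Lemma spiral_radius m w a b q :
  spiral m w a b q * spiral m w a b q +
  spiral m w b (- a) q * spiral m w b (- a) q =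
  (a * a + b * b) * expR (2 * m * q).
Proof.
rewrite /spiral (_ : 2 * m * q = m * q + m * q); last by ring.
rewrite expRD; have := cos2Dsin2 (w * q); rewrite !expr2 => cs.
set e := expR _; rewrite -[RHS]mulr1 -cs; ring.
Qed.

End Curves.

Section Cases.
Variables (R : realType) (G : lieGroupType R 3).
Hypothesis Gconn : connected [set: G].
Variables (L : solvable4 R) (iota : lie_algebra_iso G (bracket4 L)).
Variables TX TY TZ XY : 'rV[R]_4.
Hypothesis LE : basis_brackets L = (TX, TY, TZ, XY).
Variable F : 'rV[R]_4.

Lemma nontrivial_brackets :
  (forall F0, coadjoint_orbit iota F <> [set F0]) ->
  [|| pairing F TX != 0, pairing F TY != 0, pairing F TZ != 0 | pairing F XY != 0].
Proof.
move=> nt; apply/negP => /negP; rewrite !negb_or !negbK.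
move=> /and4P[/eqP x0 /eqP y0 /eqP z0 /eqP xy0]; apply: (nt F).
apply: (@coadjoint_orbit_trivial _ _ _ _ iota Gconn) => A A'.
by rewrite (pairing_bracket4 _ _ _ LE) x0 y0 z0 xy0 !mulr0 !addr0.
Qed.

Lemma bracket_cylinder (x y z x' y' z' : R -> R) :
  (forall q, is_derive q (1 : R) x (x' q)) ->
  (forall q, is_derive q (1 : R) y (y' q)) ->
  (forall q, is_derive q (1 : R) z (z' q)) ->
  smooth_on [set: R] x -> smooth_on [set: R] y -> smooth_on [set: R] z ->
  (forall pq, [/\ pairing (cylinder x y z pq) TX = x' pq.2,
    pairing (cylinder x y z pq) TY = y' pq.2,
    pairing (cylinder x y z pq) TZ = z' pq.2 &
    pairing (cylinder x y z pq) XY = 0]) ->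
  [/\ x 0 = F 0 0, y 0 = F 0 1 & z 0 = F 0 2] ->
  (exists (U : set 'rV[R]_4) (tau : 'rV[R]_4 -> R), [/\ open U, smooth_on U tau &
    forall pq, U (cylinder x y z pq) /\ tau (cylinder x y z pq) = pq.2]) ->
  canonical_coordinates iota F.
Proof.
move=> xD yD zD xC yC zC bE [x0 y0 z0] tau.
have -> : F = cylinder x y z (F 0 3, 0).
  by apply: row4_ext; rewrite row4E.
apply: (cylinder_orbit iota Gconn xD yD zD) => // pq A A'.
have [hx hy hz hxy] := bE pq.
by rewrite (pairing_bracket4 _ _ _ LE) hx hy hz hxy mulr0 addr0.
Qed.

Lemma expoly_cylinder (m0 a0 b0 c0 m1 a1 b1 c1 m2 a2 b2 c2 : R) :
  (forall pq, let C := cylinder (expoly m0 a0 b0 c0) (expoly m1 a1 b1 c1)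
       (expoly m2 a2 b2 c2) pq in
    [/\ pairing C TX = m0 * C 0 0 + expoly m0 b0 (2 * c0) 0 pq.2,
    pairing C TY = m1 * C 0 1 + expoly m1 b1 (2 * c1) 0 pq.2,
    pairing C TZ = m2 * C 0 2 + expoly m2 b2 (2 * c2) 0 pq.2 &
    pairing C XY = 0]) ->
  [/\ a0 = F 0 0, a1 = F 0 1 & a2 = F 0 2] ->
  (exists (U : set 'rV[R]_4) (tau : 'rV[R]_4 -> R), [/\ open U, smooth_on U tau &
    forall pq, let C := cylinder (expoly m0 a0 b0 c0) (expoly m1 a1 b1 c1)
       (expoly m2 a2 b2 c2) pq in U C /\ tau C = pq.2]) ->
  canonical_coordinates iota F.
Proof.
move=> bE [x0 y0 z0] tau.
apply: (bracket_cylinder (@is_derive_expoly R m0 a0 b0 c0)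
  (@is_derive_expoly R m1 a1 b1 c1) (@is_derive_expoly R m2 a2 b2 c2)).
- exact: expoly_smooth.
- exact: expoly_smooth.
- exact: expoly_smooth.
- by move=> pq; have := bE pq; rewrite /= !row4E.
- by rewrite !expoly0.
- exact: tau.
Qed.

Lemma time_of_coord (i : 'I_4) (C : R * R -> 'rV[R]_4) (m : R) : m != 0 ->
  F 0 i != 0 -> (forall pq, C pq 0 i = expoly m (F 0 i) 0 0 pq.2) ->
  exists (U : set 'rV[R]_4) (tau : 'rV[R]_4 -> R), [/\ open U, smooth_on U tau &
    forall pq, U (C pq) /\ tau (C pq) = pq.2].
Proof.
move=> m0 Fi CE; apply: (@log_time R _ C _ m _ (@coord_smooth R i) m0 Fi) => pq.
by rewrite CE /expoly !mul0r !addr0 mulrC.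
Qed.

End Cases.

(** * The ten families of groups *)

Section Groups.
Variables (R : realType) (G : lieGroupType R 3).
Hypothesis Gconn : connected [set: G].
Variable F : 'rV[R]_4.

Ltac brackets := rewrite /= /cylinder !pairing4 !row4E !mxE /=;
  split; rewrite /expoly /spiral; ring.
Ltac trivial_brackets := rewrite !pairing4 !mxE /= ?(mul0r, mulr0, addr0,
  subr0, add0r, oppr0, mulr1, mulrN1, eqxx).

(** As ad T is nilpotent, the time is an affine function of the first coordinate
    instead of a logarithm. *)
Lemma orbit_G411 (iota : lie_algebra_iso G (bracket4 G411)) :
  (forall F0, coadjoint_orbit iota F <> [set F0]) ->
  canonical_coordinates iota F.
Proof.
move/(@nontrivial_brackets _ _ Gconn _ iota _ _ _ _ erefl F);
  trivial_brackets; rewrite /= !orbF => F2.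
apply: (@expoly_cylinder _ _ Gconn _ iota _ _ _ _ erefl F
  0 (F 0 0) (F 0 2) 0 0 (F 0 1) 0 0 0 (F 0 2) 0 0) => [pq||].
- by brackets.
- by [].
exists setT, (fun u => (F 0 2)^-1 * (u 0 0 - F 0 0)); split; first exact: openT.
  move=> k; apply: (CkM openT); first exact: Ck_cst.
  by apply: (CkD openT); [exact: coord_smooth|exact: Ck_cst].
move=> pq; split => //=; rewrite /cylinder row4E /expoly mul0r expR0.
by field.
Qed.

Lemma orbit_G412 (iota : lie_algebra_iso G (bracket4 G412)) :
  (forall F0, coadjoint_orbit iota F <> [set F0]) ->
  canonical_coordinates iota F.
Proof.
move/(@nontrivial_brackets _ _ Gconn _ iota _ _ _ _ erefl F);
  trivial_brackets; rewrite /= !orbF => F2.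
apply: (@expoly_cylinder _ _ Gconn _ iota _ _ _ _ erefl F
  0 (F 0 0) 0 0 0 (F 0 1) 0 0 1 (F 0 2) 0 0) => [pq||].
- by brackets.
- by [].
by apply: (@time_of_coord _ F 2 _ 1) => // pq; rewrite /cylinder row4E.
Qed.

Lemma orbit_G421 l (iota : lie_algebra_iso G (bracket4 (G421 l))) : l <> 0 ->
  (forall F0, coadjoint_orbit iota F <> [set F0]) ->
  canonical_coordinates iota F.
Proof.
move=> /eqP l0.
move/(@nontrivial_brackets _ _ Gconn _ iota _ _ _ _ erefl F); trivial_brackets.
rewrite /= !orbF => F12.
apply: (@expoly_cylinder _ _ Gconn _ iota _ _ _ _ erefl F
  0 (F 0 0) 0 0 l (F 0 1) 0 0 1 (F 0 2) 0 0) => [pq||].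
- by brackets.
- by [].
have [F1|F1] := eqVneq (F 0 1) 0; last first.
  by apply: (@time_of_coord _ F 1 _ l) => // pq; rewrite /cylinder row4E.
have F2 : F 0 2 != 0 by move: F12; rewrite F1 mul0r eqxx.
by apply: (@time_of_coord _ F 2 _ 1) => // pq; rewrite /cylinder row4E.
Qed.

Lemma orbit_G422 (iota : lie_algebra_iso G (bracket4 G422)) :
  (forall F0, coadjoint_orbit iota F <> [set F0]) ->
  canonical_coordinates iota F.
Proof.
move/(@nontrivial_brackets _ _ Gconn _ iota _ _ _ _ erefl F);
  trivial_brackets; rewrite /= !orbF => F12.
apply: (@expoly_cylinder _ _ Gconn _ iota _ _ _ _ erefl F
  0 (F 0 0) 0 0 1 (F 0 1) 0 0 1 (F 0 2) (F 0 1) 0) => [pq||].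
- by brackets.
- by [].
have [F1|F1] := eqVneq (F 0 1) 0; last first.
  by apply: (@time_of_coord _ F 1 _ 1) => // pq; rewrite /cylinder row4E.
have F2 : F 0 2 != 0 by move: F12; rewrite F1 add0r eqxx.
by apply: (@time_of_coord _ F 2 _ 1) => // pq; rewrite /cylinder row4E F1.
Qed.

Lemma orbit_G431 l1 l2 (iota : lie_algebra_iso G (bracket4 (G431 l1 l2))) :
  l1 <> 0 -> l2 <> 0 ->
  (forall F0, coadjoint_orbit iota F <> [set F0]) ->
  canonical_coordinates iota F.
Proof.
move=> /eqP l10 /eqP l20.
move/(@nontrivial_brackets _ _ Gconn _ iota _ _ _ _ erefl F); trivial_brackets.
rewrite /= !orbF => F012.
apply: (@expoly_cylinder _ _ Gconn _ iota _ _ _ _ erefl F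
  l1 (F 0 0) 0 0 l2 (F 0 1) 0 0 1 (F 0 2) 0 0) => [pq||].
- by brackets.
- by [].
have [F0|F0] := eqVneq (F 0 0) 0; last first.
  by apply: (@time_of_coord _ F 0 _ l1) => // pq; rewrite /cylinder row4E.
have [F1|F1] := eqVneq (F 0 1) 0; last first.
  by apply: (@time_of_coord _ F 1 _ l2) => // pq; rewrite /cylinder row4E.
have F2 : F 0 2 != 0 by move: F012; rewrite F0 F1 !mul0r eqxx.
by apply: (@time_of_coord _ F 2 _ 1) => // pq; rewrite /cylinder row4E.
Qed.

Lemma orbit_G432 l (iota : lie_algebra_iso G (bracket4 (G432 l))) : l <> 0 ->
  (forall F0, coadjoint_orbit iota F <> [set F0]) ->
  canonical_coordinates iota F.
Proof.
move=> /eqP l0.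
move/(@nontrivial_brackets _ _ Gconn _ iota _ _ _ _ erefl F); trivial_brackets.
rewrite /= !orbF => F012.
apply: (@expoly_cylinder _ _ Gconn _ iota _ _ _ _ erefl F
  l (F 0 0) 0 0 l (F 0 1) (F 0 0) 0 1 (F 0 2) 0 0) => [pq||].
- by brackets.
- by [].
have [F2|F2] := eqVneq (F 0 2) 0; last first.
  by apply: (@time_of_coord _ F 2 _ 1) => // pq; rewrite /cylinder row4E.
have [F0|F0] := eqVneq (F 0 0) 0; last first.
  by apply: (@time_of_coord _ F 0 _ l) => // pq; rewrite /cylinder row4E.
have F1 : F 0 1 != 0.
  by apply: contraTneq F012 => F1; rewrite F0 F1 F2 !mul0r addr0 eqxx.
by apply: (@time_of_coord _ F 1 _ l) => // pq; rewrite /cylinder row4E F0.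
Qed.

Lemma orbit_G433 (iota : lie_algebra_iso G (bracket4 G433)) :
  (forall F0, coadjoint_orbit iota F <> [set F0]) ->
  canonical_coordinates iota F.
Proof.
move/(@nontrivial_brackets _ _ Gconn _ iota _ _ _ _ erefl F);
  trivial_brackets; rewrite /= !orbF => F012.
apply: (@expoly_cylinder _ _ Gconn _ iota _ _ _ _ erefl F
  1 (F 0 0) 0 0 1 (F 0 1) (F 0 0) 0 1 (F 0 2) (F 0 1) (F 0 0 / 2)) => [pq||].
- by rewrite mulrCA mulfV ?pnatr_eq0// mulr1; brackets.
- by [].
have [F0|F0] := eqVneq (F 0 0) 0; last first.
  by apply: (@time_of_coord _ F 0 _ 1) => // pq; rewrite /cylinder row4E.
have [F1|F1] := eqVneq (F 0 1) 0; last first.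
  by apply: (@time_of_coord _ F 1 _ 1) => // pq; rewrite /cylinder row4E F0.
have F2 : F 0 2 != 0 by apply: contraTneq F012 => F2; rewrite F0 F1 F2 !addr0 eqxx.
by apply: (@time_of_coord _ F 2 _ 1) => // pq; rewrite /cylinder row4E F1 F0 mul0r.
Qed.

Lemma cos_neq0 (phi : R) : 0 < phi < pi -> phi <> pi / 2 -> cos phi != 0.
Proof.
move=> /andP[phi0 phipi] phi2; apply/eqP => cphi; apply: phi2.
apply: cos_inj; rewrite ?in_itv /= ?cos_pihalf//; first by rewrite !ltW.
by rewrite divr_ge0 ?pi_ge0//= ler_pdivrMr// ler_peMr ?pi_ge0// ler1n.
Qed.

(** On a spiral the time is read off the radius, which is multiplied by e^(m q). *)
Lemma time_of_radius (i j : 'I_4) (C : R * R -> 'rV[R]_4) (m w : R) : m != 0 ->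
  (F 0 i != 0) || (F 0 j != 0) ->
  (forall pq, C pq 0 i = spiral m w (F 0 i) (F 0 j) pq.2) ->
  (forall pq, C pq 0 j = spiral m w (F 0 j) (- F 0 i) pq.2) ->
  exists (U : set 'rV[R]_4) (tau : 'rV[R]_4 -> R), [/\ open U, smooth_on U tau &
    forall pq, U (C pq) /\ tau (C pq) = pq.2].
Proof.
move=> m0 Fij Ci Cj.
have m20 : 2 * m != 0 by rewrite mulf_neq0// pnatr_eq0.
have F0 : F 0 i * F 0 i + F 0 j * F 0 j != 0.
  rewrite -!expr2 paddr_eq0 ?sqr_ge0// !sqrf_eq0 negb_and; exact: Fij.
apply: (@log_time R _ C _ _ _ (@sqr_smooth R i j) m20 F0) => pq.
by rewrite Ci Cj spiral_radius.
Qed.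

Lemma orbit_G423 phi (iota : lie_algebra_iso G (bracket4 (G423 phi))) :
  0 < phi < pi -> phi <> pi / 2 ->
  (forall F0, coadjoint_orbit iota F <> [set F0]) ->
  canonical_coordinates iota F.
Proof.
move=> phi0 phi2.
move/(@nontrivial_brackets _ _ Gconn _ iota _ _ _ _ erefl F); trivial_brackets.
rewrite /= !orbF => F12; have c0 := cos_neq0 phi0 phi2.
apply: (@bracket_cylinder _ _ Gconn _ iota _ _ _ _ erefl F _ _ _ _ _ _
  (@is_derive_expoly R 0 (F 0 0) 0 0)
  (@is_derive_spiral R (cos phi) (sin phi) (F 0 1) (F 0 2))
  (@is_derive_spiral R (cos phi) (sin phi) (F 0 2) (- F 0 1))).
- exact: expoly_smooth.
- exact: spiral_smooth.
- exact: spiral_smooth.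
- by move=> pq; brackets.
- by rewrite !spiral0 expoly0.
apply: (@time_of_radius 1 2 _ (cos phi) (sin phi)) => // [|pq|pq];
  rewrite /cylinder ?row4E//.
rewrite -negb_and; apply: contraTN F12 => /andP[/eqP -> /eqP ->].
by rewrite !mul0r !(subr0, addr0) eqxx.
Qed.

Lemma orbit_G434 l phi (iota : lie_algebra_iso G (bracket4 (G434 l phi))) :
  l <> 0 -> 0 < phi < pi -> phi <> pi / 2 ->
  (forall F0, coadjoint_orbit iota F <> [set F0]) ->
  canonical_coordinates iota F.
Proof.
move=> /eqP l0 phi0 phi2.
move/(@nontrivial_brackets _ _ Gconn _ iota _ _ _ _ erefl F); trivial_brackets.
rewrite /= !orbF => F012; have c0 := cos_neq0 phi0 phi2.
apply: (@bracket_cylinder _ _ Gconn _ iota _ _ _ _ erefl F _ _ _ _ _ _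
  (@is_derive_spiral R (cos phi) (sin phi) (F 0 0) (F 0 1))
  (@is_derive_spiral R (cos phi) (sin phi) (F 0 1) (- F 0 0))
  (@is_derive_expoly R l (F 0 2) 0 0)).
- exact: spiral_smooth.
- exact: spiral_smooth.
- exact: expoly_smooth.
- by move=> pq; brackets.
- by rewrite !spiral0 expoly0.
have [F2|F2] := eqVneq (F 0 2) 0; last first.
  by apply: (@time_of_coord _ F 2 _ l) => // pq; rewrite /cylinder row4E.
apply: (@time_of_radius 0 1 _ (cos phi) (sin phi)) => // [|pq|pq];
  rewrite /cylinder ?row4E//.
rewrite -negb_and; apply: contraTN F012 => /andP[/eqP -> /eqP ->].
by rewrite F2 !mul0r !(subr0, addr0) eqxx.
Qed.

(** The bracket [X,Y] = Z is annihilated by F, and the orbit is a cylinder, exactly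
    when the coordinate F 0 2 vanishes. *)
Lemma orbit_G442 (iota : lie_algebra_iso G (bracket4 G442)) :
  (forall F0, coadjoint_orbit iota F <> [set F0]) ->
  canonical_coordinates iota F.
Proof.
move/(@nontrivial_brackets _ _ Gconn _ iota _ _ _ _ erefl F); trivial_brackets => F012.
have [F2|F2] := eqVneq (F 0 2) 0; last first.
  have -> : F = saddle (F 0 2) (F 0 3 - F 0 0 / F 0 2 * F 0 1)
      (F 0 0 / F 0 2, F 0 1).
    by apply: row4_ext; rewrite row4E //=; field.
  apply: saddle_orbit => // F' A A'.
  rewrite (@pairing_bracket4 R G442 _ _ _ _ _ _ _ erefl) !pairing4 !mxE /=; ring.
apply: (@expoly_cylinder _ _ Gconn _ iota _ _ _ _ erefl F
  (-1) (F 0 0) 0 0 1 (F 0 1) 0 0 0 0 0 0) => [pq||].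
- by brackets.
- by rewrite F2.
have [F0|F0] := eqVneq (F 0 0) 0; last first.
  apply: (@time_of_coord _ F 0 _ (-1)) => // pq.
  by rewrite /cylinder row4E.
have F1 : F 0 1 != 0.
  by apply: contraTneq F012 => F1; rewrite F0 F1 F2 !(mul0r, mulr0, oppr0, eqxx).
by apply: (@time_of_coord _ F 1 _ 1) => // pq; rewrite /cylinder row4E.
Qed.

End Groups.

Unset Implicit Arguments.

Theorem proposition3p1p1 (R : realType) (L : solvable4 R)
    (hL : admissible L) (hphi : angle_not_right L)
    (G : lieGroupType R 3)
    (Gconn : connected [set: G]) (Gsc : simply_connected R G)
    (iota : lie_algebra_iso G (bracket4 L))
    (F : 'rV[R]_4)
    (nontrivial : forall F0, coadjoint_orbit iota F <> [set F0]) :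
  exists psi : R * R -> 'rV[R]_4,
    [/\ diffeomorphism_onto (coadjoint_orbit iota F) psi,
        forall A : 'rV[R]_4, exists Phi Psi : R -> R,
          [/\ smooth_on [set: R] Phi, smooth_on [set: R] Psi &
              forall p q, pairing (psi (p, q)) A = Phi q * p + Psi q] &
        exists2 omega : 'rV[R]_4 -> 'rV[R]_4 -> 'rV[R]_4 -> R,
          Kirillov_form iota (coadjoint_orbit iota F) omega &
          forall x u v : R * R,
            omega (psi x) ('d psi x u) ('d psi x v)
              = u.1 * v.2 - v.1 * u.2].
Proof.
change (canonical_coordinates iota F).
case: L hL hphi iota nontrivial => /=
  [_ _|_ _|l l0 _|_ _|phi phi0 phi2|l1 l2 [l10 l20] _|l l0 _|_ _
  |l phi [l0 phi0] phi2|_ _] iota nt.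
- exact: orbit_G411.
- exact: orbit_G412.
- exact: orbit_G421.
- exact: orbit_G422.
- exact: orbit_G423.
- exact: orbit_G431.
- exact: orbit_G432.
- exact: orbit_G433.
- exact: orbit_G434.
- exact: orbit_G442.
Qed.
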